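(* For every simple cubic graph $G$ one has $\chi'_N(G)\leq 7$; that is, $G$ admits a normal $7$-edge-coloring.
   Context: A $k$-edge-coloring of a graph is an assignment of colors from $\{1,\dots,k\}$ to its edges such that adjacent edges receive different colors. For an edge-coloring $c$ and a vertex $v$, let $S_c(v)$ be the set of colors of the edges incident to $v$. In a cubic graph, an edge $uv$ is poor with respect to $c$ if $|S_c(u)\cup S_c(v)|=3$ and rich if $|S_c(u)\cup S_c(v)|=5$. An edge-coloring of a cubic graph is normal if every edge is poor or rich. For a simple cubic graph $G$, $\chi'_N(G)$ denotes the smallest $k$ such that $G$ admits a normal $k$-edge-coloring. Graphs need not be connected or bridgeless. *)

(* Defs.v *)
From mathcomp Require Import all_boot.

Set Implicit Arguments.
Unset Strict Implicit.
Unset Printing Implicit Defensive.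

(* Finite simple graphs; neither nonemptiness nor connectedness is required. *)
Record sgraph := SGraph {
  vertex :> finType;
  adj : rel vertex;
  adj_sym : symmetric adj;
  adj_irrefl : irreflexive adj }.

Definition edges (G : sgraph) : {set {set G}} :=
  [set [set u; v] | u in [set: G], v in [set w | adj u w]].

Definition edge (G : sgraph) : predArgType := {e : {set G} | e \in edges G}.

Definition cubic (G : sgraph) : bool :=
  [forall v : G, #|[set u | adj v u]| == 3].

Section Coloring.
Variables (G : sgraph) (k : nat).

Definition adjacent_edges (e f : edge G) : bool :=
  (e != f) && (val e :&: val f != set0).

(* The colors 1, ..., k are represented by the elements 0, ..., k - 1 of 'I_k. *)
Definition edge_coloring (c : {ffun edge G -> 'I_k}) : bool :=
  [forall e, forall f, adjacent_edges e f ==> (c e != c f)].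

Definition colors_at (c : {ffun edge G -> 'I_k}) (v : G) : {set 'I_k} :=
  [set c e | e : edge G & v \in val e].

Definition poor (c : {ffun edge G -> 'I_k}) (u v : G) : bool :=
  #|colors_at c u :|: colors_at c v| == 3.

Definition rich (c : {ffun edge G -> 'I_k}) (u v : G) : bool :=
  #|colors_at c u :|: colors_at c v| == 5.

Definition normal_edge_coloring (c : {ffun edge G -> 'I_k}) : bool :=
  edge_coloring c &&
  [forall u, forall v, adj u v ==> poor c u v || rich c u v].

Definition has_normal_edge_coloring : bool :=
  [exists c : {ffun edge G -> 'I_k}, normal_edge_coloring c].

End Coloring.

Lemma edge_of_adj (G : sgraph) (u v : G) : adj u v -> [set u; v] \in edges G.
Proof. by move=> uv; apply/imset2P; exists u v; rewrite ?inE. Qed.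

Definition edge_of (G : sgraph) (u v : G) (uv : adj u v) : edge G :=
  exist (fun e => e \in edges G) [set u; v] (edge_of_adj uv).

Lemma card_edges_at (G : sgraph) (v : G) : cubic G ->
  #|[set e : edge G | v \in val e]| = 3.
Proof.
move=> /forallP/(_ v)/eqP <-.
rewrite -(card_imset _ val_inj).
have inj : {in [set u | adj v u] &, injective (fun u : G => [set v; u])}.
  move=> a b; rewrite !inE => va _ /setP/(_ a); rewrite !inE eqxx orbT => /esym.
  case: (a =P v) => [av|_ /= /eqP //].
  by move: va; rewrite av adj_irrefl.
rewrite -(card_in_imset inj); apply: eq_card => A.
apply/imsetP/imsetP => [[[B BE]] | [u]]; rewrite inE /=.
  move=> vB ->; case/imset2P: (BE) vB => x y _; rewrite inE => xy ->; rewrite !inE => /orP[] /eqP->.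
    by exists y; rewrite ?inE.
  by exists x; rewrite ?inE 1?adj_sym // setUC.
move=> vu ->; exists (edge_of vu) => //.
by rewrite !inE eqxx.
Qed.

(* Giving all edges distinct colors makes every edge rich. *)
Lemma cubic_has_normal_edge_coloring (G : sgraph) :
  cubic G -> exists k, has_normal_edge_coloring G k.
Proof.
move=> cubG; exists #|edge G|; apply/existsP.
pose c := [ffun e : edge G => enum_rank e].
have c_inj : injective c by move=> e f; rewrite !ffunE => /enum_rank_inj.
exists c; apply/andP; split.
  apply/forallP=> e; apply/forallP=> f; apply/implyP=> /andP[+ _].
  by apply: contra_neq => /c_inj.
apply/forallP=> u; apply/forallP=> v; apply/implyP=> uv; apply/orP; right.
pose at_ w := [set e : edge G | w \in val e].
have colE w : colors_at c w = c @: at_ w by [].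
have uNv : u != v by apply: contraTneq uv => ->; rewrite adj_irrefl.
rewrite /rich !colE -imsetU card_imset // cardsU !card_edges_at //.
suff -> : at_ u :&: at_ v = [set edge_of uv] by rewrite cards1.
apply/setP=> -[B BE]; rewrite !inE -val_eqE /=.
apply/andP/eqP => [[] | ->]; last by rewrite !inE !eqxx orbT.
case/imset2P: (BE) => x y _ _ ->; rewrite !inE.
move=> uxy vxy; case/orP: uxy vxy uNv => /eqP-> /orP[] /eqP->.
all: by rewrite ?eqxx // setUC.
Qed.

Definition normal_chromatic_index (G : sgraph) (cubG : cubic G) : nat :=
  ex_minn (cubic_has_normal_edge_coloring cubG).

(* Main.v *)
Require Import Defs.
From mathcomp Require Import all_boot.
From mathcomp Require Import order ssralg ssrnum ssrint zify.

(* A nowhere-zero flow with values in (Z/2)^3 colours a cubic graph by the points of the Fano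
   plane, the three colours at a vertex forming a line; two lines through a common point are equal
   or meet only there, so every edge is poor or rich.  Bridgeless graphs have such a flow (Jaeger);
   it is built here by Seymour's closure argument, which grows an even subgraph C, adding at each
   step a closed trail attached by two edges, and then corrects a (Z/2)^2-valued flow off C along
   circuits that contain at most two new edges.

   Colourings of two vertex sets joined by at most one edge are glued by permuting colours, which
   leaves 2-edge-connected sets S with k boundary edges.  For k <> 1 the flow of the graph obtained
   by contracting the complement works.  For k = 1 take a minimal X in S with two boundary edges
   d1, d2, at x and y.  Then the closure can start from a closed trail C0 through x and y, so
   d1 and d2 may carry any value (0, al), and al can be chosen so that the edges of C0 at x are
   rich.  The lines at the two other neighbours of x meet in a point u off the line at x, and
   adding u to the colour of d1 alone keeps every edge inside X normal while making d1 and d2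
   differ.  The flow on S with X contracted, with an extra edge from X to the outside, also
   separates d1 from d2, and a permutation of the colours makes the two colourings fit. *)

Set Implicit Arguments.
Unset Strict Implicit.
Unset Printing Implicit Defensive.

Import GRing.Theory Num.Theory.
Local Open Scope ring_scope.

Local Notation color2 := (bool * bool)%type.
Local Notation color3 := (bool * (bool * bool))%type.

(** * Cuts, divergence and joins in multigraphs *)

Section Multigraph.
Variables (V E : finType) (s t : E -> V).

Definition edge_cut (X : {set V}) : {set E} :=
  [set e | (s e \in X) != (t e \in X)].

Local Notation cut := edge_cut.

Definition inside (X : {set V}) : {set E} :=
  [set e | (s e \in X) && (t e \in X)].

Definition divergence (M : zmodType) (f : E -> M) (v : V) : M :=
  \sum_(e | s e == v) f e - \sum_(e | t e == v) f e.

Local Notation div := divergence.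

Lemma eq_div (M : zmodType) (f g : E -> M) : f =1 g -> div f =1 div g.
Proof. by move=> fg v; rewrite /divergence; congr (_ - _); apply: eq_bigr. Qed.

Lemma div0 (M : zmodType) v : div (fun=> 0 : M) v = 0.
Proof. by rewrite /divergence !big1 ?subr0. Qed.

Lemma divD (M : zmodType) (f g : E -> M) v :
  div (fun e => f e + g e) v = div f v + div g v.
Proof. by rewrite /divergence !big_split /= opprD addrACA. Qed.

(** Serves to take coordinates of a flow, to reduce an integer flow modulo 2, and to multiply a join
    by a vector. *)
Lemma div_additive (M N : zmodType) (h : M -> N) (f : E -> M) v :
  (forall x y, h (x + y) = h x + h y) ->
  div (fun e => h (f e)) v = h (div f v).
Proof.
move=> hD; have h0 : h 0 = 0 by apply: (addrI (h 0)); rewrite -hD !addr0.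
have hN x : h (- x) = - h x by apply: (addrI (h x)); rewrite -hD !subrr.
by rewrite /divergence hD hN !(big_morph h hD h0).
Qed.

Lemma div_edge (M : zmodType) (a : M) e0 v :
  div (fun e => if e == e0 then a else 0) v =
  (if s e0 == v then a else 0) - (if t e0 == v then a else 0).
Proof.
rewrite /divergence; congr (_ - _); rewrite -big_mkcondr /=.
  by rewrite (big_mkcond (fun e => _)) (bigD1 e0) //= eqxx andbT big1 ?addr0 // => e /negPf->;
      rewrite andbF.
by rewrite (big_mkcond (fun e => _)) (bigD1 e0) //= eqxx andbT big1 ?addr0 // => e /negPf->;
    rewrite andbF.
Qed.

(** An edge with both ends in [X] contributes once with each sign and cancels. *)
Lemma sum_div (M : zmodType) (f : E -> M) (X : {set V}) :
  \sum_(v in X) div f v =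
  \sum_(e | (s e \in X) && (t e \notin X)) f e -
  \sum_(e | (t e \in X) && (s e \notin X)) f e.
Proof.
have sumP (h : E -> V) : \sum_(v in X) \sum_(e | h e == v) f e = \sum_(e | h e \in X) f e.
  rewrite (exchange_big_dep (fun e => h e \in X)) /=; last by move=> v e vX /eqP->.
  apply: eq_bigr => e eX; rewrite (big_pred1 (h e)) // => v /=.
  by rewrite eq_sym; case: eqP => [->|]; rewrite ?eX ?andbF.
rewrite /divergence sumrB !sumP.
rewrite (bigID (fun e => t e \in X)) /= [X in _ - X](bigID (fun e => s e \in X)) /=.
rewrite (eq_bigl (fun e => (s e \in X) && (t e \in X))); last by move=> e.
rewrite [X in _ - (X + _)](eq_bigl (fun e => (s e \in X) && (t e \in X))); last by move=> e;
    rewrite andbC.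
by rewrite opprD addrACA subrr add0r.
Qed.

Lemma cutC (X : {set V}) : cut (~: X) = cut X.
Proof. by apply/setP => e; rewrite !inE; do 2 case: (_ \in _). Qed.

(* J is a T-join for T = {u, w}: the vertices of odd degree in J are u and w. *)
Definition joined (F : {set E}) (u w : V) :=
  exists J : E -> bool, (forall e, J e -> e \in F) /\
    (forall v, div J v = (v == u) + (v == w)).

Lemma joined_refl F u : joined F u u.
Proof.
by exists (fun=> false); split=> // v; rewrite -[false]/(0:bool) div0; case: (v == u).
Qed.

Lemma joined_sym F u w : joined F u w -> joined F w u.
Proof. by case=> J [JF Jd]; exists J; split=> // v; rewrite Jd addrC. Qed.

(** Booleans add as elements of Z/2, so the witness is the symmetric difference of the two joins,
    and the contributions at [v] cancel. *)
Lemma joined_trans F u v w : joined F u v -> joined F v w -> joined F u w.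
Proof.
case=> [J [JF Jd]] [K [KF Kd]]; exists (fun e => J e + K e); split=> [e|x].
  by have := JF e; have := KF e; case: (J e) (K e) => [] [] //= h1 h2 _; auto.
by rewrite divD Jd Kd; do 3 case: (x == _).
Qed.

Lemma joined_sub (F F' : {set E}) u w : F \subset F' -> joined F u w -> joined F' u w.
Proof. by move=> FF' [J [JF Jd]]; exists J; split=> // e /JF /(subsetP FF'). Qed.

Lemma div_edge1 e0 v :
  div (fun e => e == e0 : bool) v = (v == s e0) + (v == t e0).
Proof.
rewrite (eq_div (g := fun e => if e == e0 then true else 0)); last by move=> e; case: eqP.
by rewrite div_edge !(eq_sym v); do 2 case: (_ == v).
Qed.

Definition link (F : {set E}) : rel V := fun u w =>
  [exists e, (e \in F) && (((s e == u) && (t e == w)) || ((s e == w) && (t e == u)))].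

Lemma joined_link F u w : link F u w -> joined F u w.
Proof.
case/existsP=> e /andP[eF ew]; exists (fun e' => e' == e); split=> [e' /eqP-> //|v].
by rewrite div_edge1; case/orP: ew => /andP[/eqP-> /eqP->] //; rewrite addrC.
Qed.

Lemma link_s (F : {set E}) e : e \in F -> link F (s e) (t e).
Proof. by move=> eF; apply/existsP; exists e; rewrite eF !eqxx. Qed.

Lemma link_t (F : {set E}) e : e \in F -> link F (t e) (s e).
Proof. by move=> eF; apply/existsP; exists e; rewrite eF !eqxx orbT. Qed.

(** * Two edge-disjoint paths *)

Section Residual.
Variable F : {set E}.

(** Unit capacities in both directions: a negative value is flow against the orientation of the
    edge. *)
Definition feasible (phi : E -> int) :=
  forall e, -1 <= phi e <= 1 /\ (e \notin F -> phi e = 0).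

(** The residual graph of the Ford-Fulkerson method. *)
Definition residual (phi : E -> int) : rel V := fun u w =>
  [exists e, (e \in F) &&
    ((s e == u) && (t e == w) && (phi e < 1) ||
     (t e == u) && (s e == w) && (-1 < phi e))].

(** The last clause serves the induction: the rest of the path avoids [u], so its augmentation
    leaves the first edge [e0] at its old value, which still has room for the change by [d]. *)
Lemma augment_path p u phi : feasible phi -> path (residual phi) u p ->
  uniq (u :: p) -> exists phi', [/\ feasible phi',
    forall v, div phi' v = div phi v + (u == v)%:R - (last u p == v)%:R &
    forall e, phi' e != phi e -> (s e \in u :: p) && (t e \in u :: p)].
Proof.
elim: p u phi => [|w p IH] u phi fphi /=.
  move=> _ _; exists phi; split=> // [v|e]; first by rewrite addrK.
  by rewrite eqxx.
case/andP=> /existsP[e0 /andP[e0F e0r]] pw /andP[uN uq].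
have [phi' [fphi' dphi' cphi']] := IH w phi fphi pw uq.
have e0same : phi' e0 = phi e0.
  apply/eqP; apply: contraNT uN => /cphi' /andP[].
  by case/orP: e0r => /andP[/andP[/eqP-> /eqP->] _].
have uw : u != w by apply: contraNneq uN => ->; rewrite mem_head.
pose d : int := if s e0 == u then 1 else -1.
exists (fun e => phi' e + (if e == e0 then d else 0)); split.
- move=> e; have [b1 b2] := fphi' e; case: eqP => [ee|_]; last by rewrite addr0.
  split; last by rewrite ee e0F.
  rewrite ee e0same /d in b1 *; have [b3 _] := fphi e0.
  case/orP: e0r => /andP[/andP[/eqP e1 /eqP e2] e3].
    by rewrite e1 eqxx; lia.
  by rewrite e2 eq_sym (negPf uw); lia.
- move=> v; rewrite divD dphi' div_edge /d.
  case/orP: e0r => /andP[/andP[/eqP e1 /eqP e2] e3]; rewrite e1 e2.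
    by rewrite eqxx; case: (u == v); case: (w == v); case: (_ == v); lia.
  rewrite [w == u]eq_sym (negPf uw).
  by case: (u == v); case: (w == v); case: (_ == v); lia.
- move=> e; case: (e =P e0) => [->|_].
    by case/orP: e0r => /andP[/andP[/eqP-> /eqP->] _]; rewrite !inE !eqxx !orbT.
  by rewrite addr0 => /cphi' /andP[h1 h2]; rewrite !in_cons in h1 h2 *; rewrite h1 h2 !orbT.
Qed.

Variables b1 b2 : V.
Hypothesis sep : forall X : {set V}, b1 \in X -> b2 \notin X -> (1 < #|cut X :&: F|)%N.

(** Max-flow min-cut. If [b2] cannot be reached in the residual graph, every edge of [F] leaving the
    reachable set [R] is saturated outwards, so [k] is the number of these edges, which is at least
    2 by [sep]. *)
Lemma augment (k : nat) phi : (k < 2)%N -> feasible phi ->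
  (forall v, div phi v = ((b1 == v)%:R - (b2 == v)%:R) *+ k) ->
  exists2 phi', feasible phi' &
    forall v, div phi' v = ((b1 == v)%:R - (b2 == v)%:R) *+ k.+1.
Proof.
move=> k2 fphi dphi.
have [|nc] := boolP (connect (residual phi) b1 b2).
  case/connectP=> p /shortenP[p' pp' up' _] b2E.
  have [phi' [fphi' dphi' _]] := augment_path fphi pp' up'.
  by exists phi' => // v; rewrite dphi' dphi mulrSr -b2E addrA.
pose R := [set v | connect (residual phi) b1 v].
have b1R : b1 \in R by rewrite inE connect0.
have b2R : b2 \notin R by rewrite inE.
have := sep b1R b2R; rewrite ltnNge => /negP[].
have RS u w : u \in R -> w \notin R -> ~~ residual phi u w.
  by rewrite !inE => b1u; apply: contra => uw; apply: connect_trans b1u (connect1 uw).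
have := sum_div phi R.
have -> : \sum_(v in R) div phi v = k%:R.
  under eq_bigr do rewrite dphi.
  rewrite sumrMnl sumrB (bigD1 b1) //= eqxx big1; last by move=> v /andP[_ /negPf];
      rewrite eq_sym => ->.
  rewrite big1 ?subr0 ?addr0 ?mulrnAl //; last by move=> v vR; case: eqP vR b2R => // -> ->.
have -> : \sum_(e | (s e \in R) && (t e \notin R)) phi e =
          \sum_(e | (s e \in R) && (t e \notin R)) (e \in F)%:R.
  apply: eq_bigr => e /andP[seR teR]; have [b c] := fphi e.
  case: (boolP (e \in F)) => [eF|/c //]; have := RS _ _ seR teR.
  by rewrite negb_exists => /forallP/(_ e); rewrite eF !eqxx /= negb_or => /andP[]; lia.
have -> : \sum_(e | (t e \in R) && (s e \notin R)) phi e =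
          - \sum_(e | (t e \in R) && (s e \notin R)) (e \in F)%:R.
  rewrite -sumrN; apply: eq_bigr => e /andP[seR teR]; have [b c] := fphi e.
  case: (boolP (e \in F)) => [eF|/c //]; have := RS _ _ seR teR.
  by rewrite negb_exists => /forallP/(_ e); rewrite eF !eqxx /= negb_or => /andP[]; lia.
rewrite opprK => kE.
have : (#|cut R :&: F|)%:R = k%:R :> int.
  rewrite kE -sum1_card natr_sum.
  rewrite (bigID (fun e => s e \in R)) /=; congr (_ + _).
    rewrite big_mkcond [RHS]big_mkcond; apply: eq_bigr => e _; rewrite !inE.
    by case: (connect _ _ (s e)); case: (connect _ _ (t e)); case: (e \in F).
  rewrite big_mkcond [RHS]big_mkcond; apply: eq_bigr => e _; rewrite !inE.
  by case: (connect _ _ (s e)); case: (connect _ _ (t e)); case: (e \in F).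
by move/eqP; rewrite eqr_nat => /eqP->.
Qed.

(** The support of a flow of value 2 works. Modulo 2 the flow is the indicator of its support and
    has divergence 0. If [b2] were not in the component of [b1], that component would emit two units
    with no flow on the edges leaving it. *)
Lemma even_connecting : exists C : {set E}, [/\ C \subset F,
  forall v, div (fun e => e \in C) v = 0 & connect (link C) b1 b2].
Proof.
have f0 : feasible (fun=> 0) by move=> e; split.
have [v|phi1 f1 d1] := augment (isT : (0 < 2)%N) f0; first by rewrite div0.
have [phi f d] := augment (isT : (1 < 2)%N) f1 d1.
exists [set e | phi e != 0]; split.
- apply/subsetP => e; rewrite inE; apply: contraR => eF.
  by have [_ ->] := f e.
- move=> v; have oddD (x y : int) : odd (absz (x + y)) = odd (absz x) + odd (absz y).
    by rewrite -[odd (absz x) + odd (absz y)]/(odd (absz x) (+) odd (absz y)); lia.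
  rewrite (eq_div (g := fun e => odd (absz (phi e)))); last first.
    by move=> e; rewrite inE; have [b _] := f e; lia.
  by rewrite (div_additive _ _ oddD) d; case: (_ == v); case: (_ == v).
- apply: contraT => nc; set C := [set e | _] in nc.
  have := sum_div phi [set v | connect (link C) b1 v].
  have nC e : (connect (link C) b1 (s e) != connect (link C) b1 (t e)) -> phi e = 0.
    case: (phi e =P 0) => // /eqP p0 /negP[]; have eC : e \in C by rewrite inE.
    apply/eqP; apply/idP/idP => h; apply: connect_trans h (connect1 _).
      exact: link_s. exact: link_t.
  rewrite [in RHS]big1; last by move=> e; rewrite !inE => /andP[h1 h2]; apply: nC;
      rewrite h1 (negPf h2).
  rewrite [in RHS]big1; last by move=> e; rewrite !inE => /andP[h1 h2]; apply: nC;
      rewrite h1 (negPf h2).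
  under eq_bigr do rewrite d.
  rewrite subr0 sumrMnl sumrB (bigD1 b1) ?inE //= eqxx big1; last by move=> v /andP[_ /negPf];
      rewrite eq_sym => ->.
  by rewrite big1 // => v; rewrite inE; case: eqP nc => // -> /negP.
Qed.

End Residual.
End Multigraph.

(** * Seymour's closure *)

Section Closure.
Variables (V E : finType) (s t : E -> V).
Local Notation cut := (edge_cut s t).
Local Notation inside := (inside s t).
Local Notation div := (divergence s t).
Local Notation joined := (joined s t).
Local Notation link := (link s t).

Lemma inside_sub (A B : {set V}) : A \subset B -> inside A \subset inside B.
Proof.
by move/subsetP=> AB; apply/subsetP=> e; rewrite !inE => /andP[/AB-> /AB->].
Qed.

(** A closed trail, possibly trivial, as an even edge set connecting [B]. Connectivity is expressed
    by joins because these can be added directly to flows. *)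
Definition cluster (B : {set V}) (C : {set E}) :=
  [/\ C \subset inside B, forall v, div (fun e => e \in C) v = 0 &
      forall u w, u \in B -> w \in B -> joined C u w].

Lemma cluster1 u : cluster [set u] set0.
Proof.
split=> [|v|v w /set1P-> /set1P->]; rewrite ?sub0set //; last exact: joined_refl.
by rewrite (eq_div _ _ (g := fun=> 0)) ?div0 // => e; rewrite inE.
Qed.

(** [B] is the component of [b1] in the even set of [even_connecting]. No edge of that set leaves
    [B], so its restriction to [B] is still even. The last clause is used to place the trail inside
    a prescribed vertex set. *)
Lemma even_cluster (F : {set E}) b1 b2 :
  (forall X : {set V}, b1 \in X -> b2 \notin X -> (1 < #|cut X :&: F|)%N) ->
  exists B C, [/\ cluster B C, C \subset F, b1 \in B, b2 \in B &
    forall A : {set V}, F \subset inside A -> b1 \in A -> B \subset A].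
Proof.
move=> sep; have [C0 [C0F C0d C0c]] := even_connecting sep.
pose B := [set v | connect (link C0) b1 v].
have BE e : e \in C0 -> (s e \in B) = (t e \in B).
  move=> eC; rewrite !inE; apply/idP/idP => h; apply: connect_trans h (connect1 _).
    exact: link_s.
  exact: link_t.
have jB v : v \in B -> joined (C0 :&: inside B) b1 v.
  rewrite inE => /connectP[p + ->].
  have b1B : b1 \in B by rewrite inE connect0.
  suff jp u : u \in B -> path (link C0) u p -> joined (C0 :&: inside B) u (last u p) by apply: jp.
  elim: p u => [|w p IH] u uB /=; first by move=> _; apply: joined_refl.
  case/andP=> uw pw; have wB : w \in B.
    by rewrite inE; apply: connect_trans (connect1 uw); rewrite inE in uB.
  apply: joined_trans (IH _ wB pw); case/existsP: uw => e /andP[eC euw].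
  apply: joined_link; apply/existsP; exists e; rewrite inE eC euw andbT /= inE.
  by case/orP: euw => /andP[/eqP-> /eqP->]; rewrite uB wB.
exists B, (C0 :&: inside B); split.
- split=> [|v|u w uB wB]; first exact: subsetIr.
    case: (boolP (v \in B)) => [vB|vNB].
      rewrite -[RHS](C0d v) /divergence; congr (_ - _); apply: eq_bigr => e /eqP ev;
          rewrite inE inE ev vB /=.
        by case: (boolP (e \in C0)) => // /BE; rewrite ev vB => <-.
      by case: (boolP (e \in C0)) => // /BE; rewrite ev vB => ->.
    rewrite /divergence !big1 ?subr0 // => e /eqP ev; rewrite inE inE ev (negPf vNB) ?andbF //=.
  by apply: joined_trans (jB w wB); apply: joined_sym; apply: jB.
- by apply: subset_trans C0F; apply: subsetIl.
- by rewrite inE connect0.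
- by rewrite inE.
- move=> A FA b1A; apply/subsetP=> v; rewrite inE => /connectP[p + ->].
  suff Ap u : u \in A -> path (link C0) u p -> last u p \in A by apply: Ap.
  elim: p u => [|w p IH] u uA //= /andP[/existsP[e /andP[eC euw]]].
  apply: IH; have := subsetP FA _ (subsetP C0F _ eC); rewrite inE.
  by case/orP: euw => /andP[/eqP-> /eqP->] /andP[].
Qed.

Definition scal (M : zmodType) (y : M) (b : bool) : M := if b then y else 0.

Lemma div_scal (M : zmodType) (y : M) (J : E -> bool) v : y + y = 0 ->
  div (fun e => scal y (J e)) v = scal y (div J v).
Proof. by move=> y2; apply: div_additive => -[] []; rewrite /= ?addr0 ?add0r. Qed.

Lemma color2_char2 (y : color2) : y + y = 0.
Proof. by case: y => [[] []]. Qed.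

(** Three forbidden values occur in [core_coloring]; a closure step has at most two. *)
Lemma color2_avoid (x1 x2 x3 : color2) : exists y : color2, [/\ y != x1, y != x2 & y != x3].
Proof.
move: x1 x2 x3 => [[] []] [[] []] [[] []]; solve [by exists (true, true) |
  by exists (true, false) | by exists (false, true) | by exists (false, false)].
Qed.

(** The invariant of the closure. The arbitrary offset [g] makes it inductive: the circuit chosen
    for the newest edges changes values on older ones, and this change is absorbed into the offset
    for the older stage. *)
Definition covered (U : {set V}) (F C : {set E}) :=
  [/\ F \subset inside U, C \subset F, forall v, div (fun e => e \in C) v = 0,
      forall u w, u \in U -> w \in U -> joined F u w &
      forall g : E -> color2, exists h : E -> color2,
        [/\ forall e, e \notin F -> h e = 0, forall v, div h v = 0 &
            forall e, e \in F -> e \notin C -> g e + h e != 0]].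

Lemma covered_cluster U C : cluster U C -> covered U C C.
Proof.
case=> CU Cd Cj; split=> // g; exists (fun=> 0); split=> // [v|e ->//].
exact: div0.
Qed.

(** One correction step. On the new edges [D] the function [h] of the older stage vanishes, so the
    value there is [g e + y], which is nonzero by the choice of [y]. On [F] the circuit is part of
    the offset to which [h] was fitted. *)
Lemma add_circuit (F C : {set E}) (D : {set E}) (y : color2) (J : E -> bool)
    (g h : E -> color2) :
  (forall v, div J v = 0) -> (forall e, J e -> e \in F :|: D) -> (forall e, e \in D -> e \notin
      F) ->
  (forall e, e \in D -> J e) ->
  (forall e, e \in D -> y != g e) ->
  [/\ forall e, e \notin F -> h e = 0, forall v, div h v = 0 &
            forall e, e \in F -> e \notin C -> (g e + scal y (J e)) + h e != 0] ->
  [/\ forall e, e \notin F :|: D -> scal y (J e) + h e = 0,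
      forall v, div (fun e => scal y (J e) + h e) v = 0 &
      forall e, e \in F :|: D -> e \notin C -> g e + (scal y (J e) + h e) != 0].
Proof.
move=> Jd JF DF DJ yD [hF hd hC]; split.
- move=> e eN; rewrite hF; last by apply: contra eN; rewrite inE => ->.
  by rewrite addr0; case: (boolP (J e)) => [/JF|//]; rewrite (negPf eN).
- by move=> v; rewrite divD hd div_scal ?color2_char2 // Jd addr0.
- move=> e; rewrite inE => /orP[eF|eD] eC; first by rewrite addrA; apply: hC.
  rewrite hF ?DF // addr0 DJ //=; apply: contra_neq (yD e eD) => gy.
  by apply: (addrI (g e)); rewrite gy color2_char2.
Qed.

(** A join of the ends of [e0] inside [F] is closed up by [e0] to a circuit, and one value of [y]
    has to be avoided. *)
Lemma covered_edge U F C e0 : covered U F C -> e0 \in inside U ->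
  covered U (e0 |: F) C.
Proof.
case=> FU CF Cd Fj Fg e0U; have [e0F|e0F] := boolP (e0 \in F).
  by rewrite (setUidPr _) ?sub1set.
split=> //; first by rewrite subUset sub1set e0U.
- by apply: subset_trans CF _; apply: subsetUr.
- by move=> u w uU wU; apply: joined_sub (Fj _ _ uU wU); apply: subsetUr.
move=> g; have [J [JF Jd]] : joined F (s e0) (t e0).
  by move: e0U; rewrite inE => /andP[]; apply: Fj.
have [y [y1 _ _]] := color2_avoid (g e0) 0 0.
pose K e := (J e + (e == e0) : bool).
have [h hP] := Fg (fun e => g e + scal y (K e)).
exists (fun e => scal y (K e) + h e); rewrite setUC.
apply: add_circuit hP => [v|e|e /set1P-> //|e /set1P->|e /set1P-> //].
- by rewrite /K divD Jd div_edge1; do 2 case: (v == _).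
- rewrite !inE /K; case: (e == e0); rewrite ?orbT // orbF => h0; apply: JF.
  by move: h0; case: (J e).
- by rewrite /K eqxx; case: (J e0) (JF e0) => // /(_ isT); rewrite (negPf e0F).
Qed.

(** The edges of [CB] enter the even subgraph, so only [e1] and [e2] need nonzero values. Both lie
    on a circuit that crosses [U] by a join in [F] and [B] by a join in [CB]; its multiple [y] has
    to avoid two values. *)
Lemma covered_union U F C B CB e1 e2 :
  covered U F C -> cluster B CB -> [disjoint U & B] -> e1 != e2 ->
  e1 \in cut U :&: cut B -> e2 \in cut U :&: cut B ->
  e1 \in inside (U :|: B) -> e2 \in inside (U :|: B) ->
  covered (U :|: B) ((F :|: CB) :|: [set e1; e2]) (C :|: CB).
Proof.
case=> FU CF Cd Fj Fg [CBB CBd CBj] dUB e12 e1c e2c e1i e2i.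
have FCB e : e \in F -> e \in CB -> False.
  move=> /(subsetP FU) + /(subsetP CBB); rewrite !inE => /andP[h _] /andP[h' _].
  by have := disjointFr dUB h; rewrite h'.
have cutNin e A : e \in cut A -> e \notin inside A.
  by rewrite !inE; case: (_ \in A); case: (_ \in A).
have endU e : e \in cut U :&: cut B -> e \in inside (U :|: B) -> exists u b,
    [/\ u \in U, b \in B & forall v, div (fun e' => e' == e : bool) v = (v == u) + (v == b)].
  have dU := disjointFr dUB; rewrite !inE => /andP[].
  case: (boolP (s e \in U)) (dU (s e)) => [sU /(_ isT) sB|sU _].
    case: (boolP (t e \in U)) => // tU _; rewrite sB /= => tB _.
    exists (s e), (t e); split=> //; last by move=> v; rewrite div_edge1.
    by case: (_ \in B) tB.
  case: (boolP (t e \in U)) (dU (t e)) => [tU /(_ isT) tB _|//].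
  rewrite tB /= => sB _; exists (t e), (s e); split=> //; last by move=> v; rewrite div_edge1 addrC.
  by case: (_ \in B) sB.
have jU : forall e u w, e \in [set e1; e2] -> u \in U -> w \in B ->
    joined (F :|: CB :|: [set e1; e2]) u w.
  move=> e u w e12e uU wB; have [ec ei] : e \in cut U :&: cut B /\ e \in inside (U :|: B).
    by move: e12e; rewrite !inE => /orP[] /eqP->; move: e1c e2c e1i e2i; rewrite !inE.
  have [u' [b' [u'U b'B eD]]] := endU e ec ei.
  apply: joined_trans (_ : joined _ u u') _.
    by apply: joined_sub (Fj _ _ uU u'U); rewrite -setUA subsetUl.
  apply: joined_trans (_ : joined _ u' b') _.
    exists (fun e' => e' == e); split=> // e' /eqP->.
    by rewrite inE e12e orbT.
  apply: joined_sub (CBj _ _ b'B wB); rewrite setUAC; exact: subsetUr.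
split.
- rewrite !subUset (subset_trans FU) ?inside_sub ?subsetUl //=.
  rewrite (subset_trans CBB) ?inside_sub ?subsetUr //=.
  by rewrite !sub1set e1i e2i.
- rewrite subUset -setUA (subset_trans CF) ?subsetUl //=.
  by rewrite setUCA subsetUl.
- move=> v; rewrite (eq_div _ _ (g := fun e => ((e \in C) + (e \in CB) : bool))).
    by rewrite divD Cd CBd.
  move=> e; rewrite inE; case: (boolP (e \in C)) => [/(subsetP CF) eF|_].
    by case: (boolP (e \in CB)) => // /(FCB _ eF).
  by case: (e \in CB).
- move=> u w; rewrite !inE => /orP[uU|uB] /orP[wU|wB].
  + by apply: joined_sub (Fj _ _ uU wU); rewrite -setUA subsetUl.
  + by apply: (jU e1) => //; rewrite !inE eqxx.
  + by apply: joined_sym; apply: (jU e1) => //; rewrite !inE eqxx.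
  + by apply: joined_sub (CBj _ _ uB wB); rewrite setUAC; apply: subsetUr.
move=> g; have [u1 [b1 [u1U b1B e1D]]] := endU _ e1c e1i.
have [u2 [b2 [u2U b2B e2D]]] := endU _ e2c e2i.
have [J [JF Jd]] := Fj _ _ u1U u2U; have [J' [J'F J'd]] := CBj _ _ b1B b2B.
have [y [y1 y2 _]] := color2_avoid (g e1) (g e2) 0.
pose K e := (J e + J' e + ((e == e1) + (e == e2)) : bool).
have [h [hF hd hC]] := Fg (fun e => g e + scal y (K e)).
exists (fun e => scal y (K e) + h e).
have e12N e : e \in [set e1; e2] -> (e \notin F :|: CB).
  move=> e12e; have : e \in cut U :&: cut B by case/set2P: e12e => ->.
  rewrite inE => /andP[/cutNin eU /cutNin eB]; rewrite inE negb_or.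
  by rewrite (contra (subsetP FU e)) // (contra (subsetP CBB e)).
apply: add_circuit => [v|e|//|e e12e|e /set2P[]->//|].
- rewrite /K !divD Jd J'd e1D e2D.
  by case: (v == u1); case: (v == b1); case: (v == u2); case: (v == b2).
- rewrite /K; case: (boolP (e \in [set e1; e2])) => [h0 _|]; first by rewrite inE h0 orbT.
  rewrite !inE negb_or => /andP[/negPf-> /negPf->].
  by have := JF e; have := J'F e; case: (J e); case: (J' e) => //= a b _;
      rewrite ?(a isT) ?(b isT) ?orbT.
- have := e12N e e12e; rewrite inE negb_or /K => /andP[eF eCB].
  have -> : J e = false by apply: contraNF eF => /JF.
  have -> : J' e = false by apply: contraNF eCB => /J'F.
  by case/set2P: e12e => ->; rewrite eqxx ?[e2 == e1]eq_sym (negPf e12).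
split=> // e; first by rewrite inE negb_or => /andP[/hF].
by rewrite !inE negb_or => /orP[eF|eCB] /andP[eC eNCB]; [apply: hC | rewrite eCB in eNCB].
Qed.

End Closure.

Lemma color3_char2 (x : color3) : x + x = 0.
Proof. by case: x => [[] [[] []]]. Qed.

Lemma color3_opp (x : color3) : - x = x.
Proof. by case: x => [[] [[] []]]. Qed.

(** * Growing the closure to the whole vertex set *)

Section Growing.
Variables (V E : finType) (s t : E -> V).
Local Notation cut := (edge_cut s t).
Local Notation inside := (inside s t).
Local Notation div := (divergence s t).
Local Notation covered := (covered s t).
Local Notation cluster := (cluster s t).

Lemma cut_inside (A B X : {set V}) : X \subset B -> B \subset A ->
  cut X :&: inside A = (cut X :&: inside B) :|: (cut X :&: cut B :&: inside A).
Proof.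
move=> /subsetP XB /subsetP BA; apply/setP=> e; rewrite !inE.
have /implyP := XB (s e); have /implyP := XB (t e).
have /implyP := BA (s e); have /implyP := BA (t e).
by case: (s e \in A); case: (t e \in A); case: (s e \in B); case: (t e \in B); case: (s e \in X);
    case: (t e \in X).
Qed.

(** Let [B0] be a smallest nonempty part of [A :\: U] with at most one edge to the rest of
    [A :\: U]. By the cut condition at least two edges [e1], [e2] join it to [U]. By minimality no
    single edge inside [B0] separates their ends [b1] and [b2], so a closed trail inside [B0] passes
    through both. The last clause says that no new edge of the even subgraph touches [U]. *)
Lemma covered_grow (A U : {set V}) (F C : {set E}) : covered U F C -> U \proper A ->
  (forall X : {set V}, X != set0 -> X \subset A :\: U -> (2 < #|cut X :&: inside A|)%N) ->
  exists U' F' C', [/\ covered U' F' C', U \proper U', U' \subset A, C \subset C' &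
    forall e, e \in C' -> (s e \in U) || (t e \in U) -> e \in C].
Proof.
move=> cU UA h3; set W := A :\: U.
pose P (X : {set V}) := [&& X != set0, X \subset W & (#|cut X :&: inside W| <= 1)%N].
have PW : P W.
  apply/and3P; split=> //.
    by move: UA; rewrite properE => /andP[_]; rewrite -setD_eq0.
  rewrite leqW // leqn0 cards_eq0 -subset0; apply/subsetP => e; rewrite !inE.
  by case/andP=> sct /andP[sW tW]; rewrite sW tW in sct.
have [B0 /and3P[B0n B0W B01] B0min] : {B0 | P B0 & forall X, P X -> (#|B0| <= #|X|)%N}.
  by case: (arg_minnP (fun X : {set V} => #|X|) PW) => B0; exists B0.
have UA' := proper_sub UA.
have WA : W \subset A by apply: subsetDl.
have B0A := subset_trans B0W WA.
have : (1 < #|cut B0 :&: cut U :&: inside A|)%N.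
  have := h3 _ B0n B0W; rewrite (cut_inside B0W WA).
  have : cut B0 :&: cut W :&: inside A \subset cut B0 :&: cut U :&: inside A.
    apply/subsetP=> e; rewrite !inE => /andP[/andP[c0 cW] /andP[sA tA]].
    by rewrite c0 sA tA; move: cW; rewrite sA tA !andbT; do 2 case: (_ \in U).
  move/subset_leq_card; move: B01;
      have := cardsU (cut B0 :&: inside W) (cut B0 :&: cut W :&: inside A).
  by lia.
case/card_gt1P=> e1 [e2 [e1P e2P e12]].
have endB e : e \in cut B0 :&: cut U :&: inside A -> {b | b \in B0 & ((s e == b) && (t e \in U))
    || ((t e == b) && (s e \in U))}.
  have sB := subsetP B0W (s e); have tB := subsetP B0W (t e).
  rewrite !inE in sB tB *; move=> /andP[/andP[h1 h2] _].
  case: (boolP (s e \in B0)) h1 => [sB0|sB0] h1; [exists (s e) => //|exists (t e)].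
  - move: h2 (sB sB0); rewrite eqxx /=; case: (s e \in U) => //; by case: (t e \in U).
  - by case: (t e \in B0) h1.
  - have tB0 : t e \in B0 by case: (t e \in B0) h1.
    by move: h2 (tB tB0); rewrite eqxx orbC /=; case: (t e \in U) => //; case: (s e \in U).
have [b1 b1B e1b] := endB _ e1P; have [b2 b2B e2b] := endB _ e2P.
(* If at most one edge inside [B0] separated [b1] from [b2], minimality would give each of the two
   halves of [B0] an edge to the rest of [W], against the choice of [B0]. *)
have sep (X : {set V}) : b1 \in X -> b2 \notin X -> (1 < #|cut X :&: inside B0|)%N.
  move=> b1X b2X; rewrite ltnNge; apply/negP => c1.
  pose crosses (Y : {set V}) := cut Y :&: cut B0 :&: inside W.
  have small (Y : {set V}) : Y \proper B0 -> Y != set0 ->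
      cut Y :&: inside B0 = cut X :&: inside B0 -> crosses Y = set0 -> False.
    move=> YB Yn YX c0; have : P Y.
      rewrite /P Yn (subset_trans (proper_sub YB) B0W) /=.
      by rewrite (cut_inside (proper_sub YB) B0W) -/(crosses Y) c0 setU0 YX.
    by move/B0min; rewrite leqNgt (proper_card YB).
  have [|[e eP]] := set_0Vmem (crosses (B0 :&: X)).
    apply: small.
    - rewrite properE subsetIl /=; apply/subsetPn; exists b2 => //.
      by rewrite inE (negPf b2X) andbF.
    - by apply/set0Pn; exists b1; rewrite inE b1B.
    - apply/setP=> e; rewrite !inE.
      by case: (s e \in B0); case: (t e \in B0); rewrite ?andbF.
  have [|[e' e'P]] := set_0Vmem (crosses (B0 :\: X)).
    apply: small.
    - rewrite properE subsetDl /=; apply/subsetPn; exists b1 => //.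
      by rewrite inE b1X.
    - by apply/set0Pn; exists b2; rewrite inE b2B b2X.
    - apply/setP=> e'; rewrite !inE.
      by case: (s e' \in B0); case: (t e' \in B0); rewrite ?andbF //=; do 2 case: (_ \in X).
  (* An edge leaving [B0] has one end in [B0], hence belongs to only one half. *)
  have ee : e != e'.
    apply: contraTneq eP => ->; apply: contraTN e'P; rewrite !inE => /andP[/andP[h1 h2] _].
    rewrite !negb_and; move: h1 h2.
    by case: (s e' \in B0); case: (t e' \in B0) => //=; rewrite ?andbT ?andbF /= => h;
        rewrite ?h //; case: (_ \in X) h.
  move: B01; rewrite leqNgt => /negP[]; apply/card_gt1P; exists e, e'; split=> //.
    by move: eP; rewrite !inE => /andP[/andP[_ ->] ->].
  by move: e'P; rewrite !inE => /andP[/andP[_ ->] ->].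
have [B [CB [cB CBB0 b1B' b2B' Bsub]]] := even_cluster sep.
have BB0 : B \subset B0 by apply: Bsub.
have dUB : [disjoint U & B].
  rewrite disjoint_sym disjoints_subset; apply: subset_trans BB0 (subset_trans B0W _).
  by apply/subsetP=> v; rewrite !inE => /andP[].
have UnB v : v \in B -> v \in U = false by move=> vB; apply: (disjointFl dUB).
exists (U :|: B), (F :|: CB :|: [set e1; e2]), (C :|: CB).
have ends e b : b \in B -> ((s e == b) && (t e \in U)) || ((t e == b) && (s e \in U)) ->
    (e \in cut U :&: cut B) && (e \in inside (U :|: B)).
  move=> bB; rewrite !inE => /orP[]/andP[/eqP-> xU];
      rewrite xU bB (UnB _ bB) (disjointFr dUB) ?orbT //.
have /andP[e1c e1i] := ends _ _ b1B' e1b; have /andP[e2c e2i] := ends _ _ b2B' e2b.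
split.
- exact: (covered_union cU cB dUB e12 e1c e2c e1i e2i).
- rewrite properE subsetUl /=; apply/subsetPn; exists b1; first by rewrite inE b1B' orbT.
  by rewrite UnB.
- by rewrite subUset UA' (subset_trans BB0).
- exact: subsetUl.
- move=> e; rewrite inE => /orP[//|eCB].
  have [/subsetP/(_ e eCB) + _ _] := cB.
  by rewrite inE => /andP[/UnB-> /UnB->].
Qed.

Lemma covered_edges U F C : covered U F C -> covered U (inside U) C.
Proof.
have [n] := ubnP #|inside U :\: F|; elim: n F => // n IH F nF cF.
have [FU _ _ _ _] := cF.
have [e0|[e]] := set_0Vmem (inside U :\: F).
  suff <- : F = inside U by [].
  by apply/eqP; rewrite eqEsubset FU -setD_eq0 e0 eqxx.
rewrite inE => /andP[eF eU]; apply: (IH (e |: F)); last exact: covered_edge.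
apply: leq_trans (proper_card _) nF; rewrite properE setDS ?subsetUr //=.
by apply/subsetPn; exists e; rewrite in_setD ?eF // in_setU1 eqxx.
Qed.

Lemma covered_full (A U : {set V}) (F C : {set E}) : covered U F C -> U \subset A ->
  (forall X : {set V}, X != set0 -> X \subset A :\: U -> (2 < #|cut X :&: inside A|)%N) ->
  exists C', [/\ covered A (inside A) C', C \subset C' &
    forall e, e \in C' -> (s e \in U) || (t e \in U) -> e \in C].
Proof.
have [n] := ubnP #|A :\: U|; elim: n U F C => // n IH U F C nU cU UA h3.
have [UA'|] := boolP (U \proper A); last first.
  rewrite properE UA negbK => AU; have UE : U = A by apply/eqP; rewrite eqEsubset UA.
  by exists C; split=> //; rewrite -UE; apply: covered_edges cU.
have [U' [F' [C' [cU' UU' U'A CC' C'e]]]] := covered_grow cU UA' h3.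
have [||C'' [cA C'C'' C''e]] := IH U' F' C' _ cU' U'A.
- apply: leq_trans (proper_card _) nU; rewrite properE (setDS _ (proper_sub UU')) //=.
  have [_ [v vU' vU]] := properP UU'.
  by apply/subsetPn; exists v; rewrite !inE ?vU ?vU' //= (subsetP U'A).
- move=> X Xn XA; apply: h3 => //; apply: subset_trans XA _; apply: setDS; exact: proper_sub.
exists C''; split=> //; first exact: subset_trans C'C''.
move=> e eC'' eU; apply: C'e => //; apply: C''e => //.
by case/orP: eU => /(subsetP (proper_sub UU'))->; rewrite ?orbT.
Qed.

(** The first coordinate is the indicator of the final even subgraph, and the second is a flow that
    is nonzero off it. Later stages add no edge of the even subgraph at [B], so near the initial
    trail the first coordinate is known exactly. *)
Lemma closure_flow (A B : {set V}) (C : {set E}) : cluster B C -> B \subset A ->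
  (forall X : {set V}, X != set0 -> X \subset A :\: B -> (2 < #|cut X :&: inside A|)%N) ->
  exists f : E -> color3, [/\ forall e, (f e != 0) = (e \in inside A),
    forall v, div f v = 0 &
    forall e, (s e \in B) || (t e \in B) -> (f e).1 = (e \in C)].
Proof.
move=> cB BA h3.
have [C' [[_ C'A C'd _ C'g] CC' C'e]] := covered_full (covered_cluster cB) BA h3.
have [h [hA hd hC]] := C'g (fun=> 0).
exists (fun e => (e \in C', h e)); split.
- move=> e; apply/idP/idP => [|eA].
    by apply: contraR => eA; rewrite hA // (contraNF (subsetP C'A e)).
  have [eC'|eC'] := boolP (e \in C'); first by [].
  by have := hC e eA eC'; rewrite add0r; apply: contra_neq => -[].
- move=> v; set f := fun e => _.
  have d1 : (div f v).1 = 0 by rewrite -(div_additive _ _ _ _ (h := fst)) //; apply: C'd.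
  have d2 : (div f v).2 = 0 by rewrite -(div_additive _ _ _ _ (h := snd)) //; apply: hd.
  by rewrite [div f v]surjective_pairing d1 d2.
- move=> e eB /=; apply/idP/idP => [eC'|/(subsetP CC') //]; exact: C'e.
Qed.

Lemma sum_div_cut (f : E -> color3) (X : {set V}) :
  \sum_(v in X) div f v = \sum_(e in cut X) f e.
Proof.
rewrite sum_div color3_opp [RHS](bigID (fun e => s e \in X)) /=; congr (_ + _).
  by apply: eq_bigl => e; rewrite inE; case: (_ \in X); case: (_ \in X).
by apply: eq_bigl => e; rewrite inE; case: (_ \in X); case: (_ \in X).
Qed.

End Growing.

(** * Contraction and nowhere-zero flows *)

Lemma div_contract (V V' E : finType) (s t : E -> V) (r : V -> V') (M : zmodType)
    (f : E -> M) v :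
  divergence (r \o s) (r \o t) f v = \sum_(x | r x == v) divergence s t f x.
Proof.
have sumP (h : E -> V) : \sum_(x | r x == v) \sum_(e | h e == x) f e = \sum_(e | r (h e) == v) f e.
  rewrite (exchange_big_dep (fun e => r (h e) == v)) /=; last by move=> x e /eqP rx /eqP hx;
      rewrite hx rx.
  apply: eq_bigr => e eX; rewrite (big_pred1 (h e)) // => x /=.
  by rewrite [h e == x]eq_sym; case: (x =P h e) => [->|]; rewrite ?eX ?andbF.
by rewrite /divergence sumrB !sumP.
Qed.

Lemma cut_contract (V V' E : finType) (s t : E -> V) (r : V -> V') (X : {set V'}) :
  edge_cut (r \o s) (r \o t) X = edge_cut s t (r @^-1: X).
Proof. by apply/setP=> e; rewrite !inE. Qed.

(* Jaeger's 8-flow theorem *)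
Lemma nowhere_zero_flow (V E : finType) (s t : E -> V) (A : {set V}) :
  (forall e, e \in inside s t A) ->
  (forall X : {set V}, X \subset A -> #|edge_cut s t X| != 1%N) ->
  exists f : E -> color3, (forall e, f e != 0) /\ (forall v, divergence s t f v = 0).
Proof.
(* The induction is on a set [A] carrying all edges, so that identifying two vertices shrinks [A]
   while the type [V] stays the same. *)
have [n] := ubnP #|A|; elim: n A s t => // n IH A s t nA inA bridgeless.
have [A0|[a aA]] := set_0Vmem A.
  have noE (e : E) : False by have := inA e; rewrite A0 !inE.
  exists (fun=> 0 : color3); split=> [e|v]; [by case: (noE e)|exact: div0].
have [/forallP h3|] := boolP [forall X : {set V}, [&& X != set0, X \subset A & a \notin X] ==> (2
    < #|edge_cut s t X|)%N].
  have [||f [fn fd _]] := @closure_flow _ _ s t A [set a] set0 (cluster1 s t a).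
  - by rewrite sub1set.
  - move=> X Xn; rewrite subsetD1 => /andP[XA aX]; have := h3 X; rewrite Xn XA aX /=.
    by rewrite (setIidPl _) //; apply/subsetP=> e.
  by exists f; split=> // e; rewrite fn.
case/forallPn=> X; rewrite negb_imply -leqNgt => /andP[/and3P[Xn XA aX] X2].
(* The cut of [X] is empty or has two edges. In the second case a cut edge [e1] is contracted; in
   the first, a vertex of [X] is identified with [a]. *)
have [u [w [e1 [uX wX wA e1P]]]] : exists u w, exists oe : option E, [/\ u \in X, w \notin X, w
    \in A &
    if oe is Some e1 then e1 \in edge_cut s t X /\ [set s e1; t e1] = [set u;
        w] else edge_cut s t X = set0].
  have [c0|[e1]] := set_0Vmem (edge_cut s t X).
    by case/set0Pn: Xn => u uX; exists u, a, None.
  move=> e1c; have := e1c; rewrite inE; have := inA e1; rewrite inE => /andP[sA tA].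
  case: (boolP (s e1 \in X)) => sX; case: (boolP (t e1 \in X)) => tX // _.
    by exists (s e1), (t e1), (Some e1).
  by exists (t e1), (s e1), (Some e1); rewrite setUC.
have uA := subsetP XA _ uX.
have uw : u != w by apply: contraNneq wX => <-.
pose r v := if v == u then w else v.
have rA v : v \in A -> r v \in A :\ u.
  by rewrite /r !inE; case: (eqVneq v u) => [_ _|h ->]; rewrite ?h // eq_sym uw wA.
have [|||f' [f'n f'd]] := IH (A :\ u) (r \o s) (r \o t).
- by move: nA; rewrite (cardsD1 u A) uA.
- by move=> e; have := inA e; rewrite inE => /andP[sA tA]; rewrite inE; apply/andP; split;
    apply: rA.
- move=> Y; rewrite subsetD1 => /andP[YA uY]; rewrite cut_contract; apply: bridgeless.
  apply/subsetP=> v; rewrite inE /r; case: eqP => [-> //|_]; exact: (subsetP YA).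
(* In the contracted graph [e1] is a loop, so its value is free. Adding [d] to it makes the sum over
   the cut of [X] vanish, which restores conservation at [u] and then at [w]. *)
pose d := \sum_(e in edge_cut s t X) f' e.
pose f e := f' e + (if Some e == e1 then d else 0).
have fX : \sum_(e in edge_cut s t X) f e = 0.
  rewrite /f big_split /= -/d; case: (e1) e1P => [e0 [e0c _]|c0]; last first.
    by rewrite /d c0 !big_set0 addr0.
  rewrite (bigD1 e0) //= eqxx [X in d + (d + X)]big1 ?addr0 ?color3_char2 // => e /andP[_ ne].
  by case: eqP => // -[] h; rewrite h eqxx in ne.
have fd v : divergence s t f v = divergence s t f' v + (if e1 is Some _ then (if v == u then d
    else 0) + (if v == w then d else 0) else 0).
  rewrite /f divD; congr (_ + _); case: (e1) e1P => [e0 [_ e0uw]|_]; last by rewrite div0.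
  rewrite (eq_div _ _ (g := fun e => if e == e0 then d else 0)); last by move=> e;
      rewrite (inj_eq Some_inj).
  rewrite div_edge color3_opp.
  have : (s e0 == u) && (t e0 == w) || (s e0 == w) && (t e0 == u).
    have : u \in [set s e0; t e0] by rewrite e0uw set21.
    have : w \in [set s e0; t e0] by rewrite e0uw set22.
    have : s e0 \in [set u; w] by rewrite -e0uw set21.
    have : t e0 \in [set u; w] by rewrite -e0uw set22.
    rewrite !inE => /orP[]/eqP-> /orP[]/eqP->; rewrite ?eqxx /= ?orbT //.
      by rewrite orbb eq_sym (negPf uw).
    by rewrite orbb (negPf uw).
  by case/orP=> /andP[/eqP-> /eqP->]; rewrite !(eq_sym v) // addrC.
have f'v v : v != u -> v != w -> divergence s t f' v = 0.
  move=> vu vw; rewrite -[RHS](f'd v) div_contract (big_pred1 v) // => x /=.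
  by rewrite /r; case: (x =P u) => [->|//]; rewrite !(eq_sym _ v) (negPf vw) (negPf vu).
have f'uw : divergence s t f' u + divergence s t f' w = 0.
  rewrite -[RHS](f'd w) div_contract (bigD1 u) /=; last by rewrite /r eqxx.
  rewrite (big_pred1 w) // => x; rewrite /= /r; case: (x =P u) => [->|];
      first by rewrite eqxx (negPf uw).
  by move=> _; rewrite andbT.
have fv v : v != u -> v != w -> divergence s t f v = 0.
  by move=> vu vw; rewrite fd f'v // (negPf vu) (negPf vw); case: (e1) => [_|]; rewrite !addr0.
have fu : divergence s t f u = 0.
  rewrite -[RHS]fX -sum_div_cut (bigD1 u) //= big1 ?addr0 // => v /andP[vX vu].
  by apply: fv => //; apply: contraNneq wX => <-.
have fw : divergence s t f w = 0.
  have : divergence s t f u + divergence s t f w = 0.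
    rewrite !fd; case: (e1) => [_|]; last by rewrite !addr0.
    by rewrite !eqxx [w == u]eq_sym (negPf uw) addr0 add0r addrACA color3_char2 addr0.
  by rewrite fu add0r.
exists f; split; last first.
  by move=> v; have [->//|vu] := eqVneq v u; have [->//|vw] := eqVneq v w; apply: fv.
move=> e; rewrite /f; case: (Some e =P e1) => [ee1|_]; last by rewrite addr0.
move: e1P; rewrite -ee1 => -[ec _].
(* With two cut edges, the corrected value on [e1] equals the value on the other one, which is
   nonzero. *)
have : #|edge_cut s t X| == 2.
  rewrite eqn_leq X2 ltn_neqAle eq_sym (bridgeless X XA) card_gt0.
  by apply/set0Pn; exists e.
case/cards2P=> x [y [xy cE]]; have {}ec := ec; rewrite cE !inE in ec.
rewrite /d cE big_setU1 ?inE //= big_set1.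
case/orP: ec => /eqP->; first by rewrite addrA color3_char2 add0r.
by rewrite addrCA color3_char2 addr0.
Qed.

(** * The Fano plane *)

Lemma color3_addK (x y : color3) : x + (x + y) = y.
Proof. by rewrite addrA color3_char2 add0r. Qed.

Lemma color3_add_eq0 (x y : color3) : (x + y == 0) = (x == y).
Proof. by rewrite -{1}(color3_opp y) subr_eq0. Qed.

(** Linear independence, written as distinctness of the eight combinations so that [perm_of_uniq]
    can send them to any other list of all colours. *)
Definition basis (a p t : color3) :=
  uniq [:: 0; a; p; a + p; t; a + t; p + t; a + p + t].

Lemma basis_free a p t : a != 0 -> p != 0 -> a != p ->
  t \notin [:: 0; a; p; a + p] -> basis a p t.
Proof.
rewrite /basis.
by move: a p t => [[] [[] []]] [[] [[] []]] [[] [[] []]].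
Qed.

Lemma basis_span a p t : basis a p t ->
  forall z, z \in [:: 0; a; p; a + p; t; a + t; p + t; a + p + t].
Proof.
move=> B z; apply: contraT => zN; have uz : uniq (z :: [:: 0; a; p; a + p; t; a + t; p + t;
    a + p + t]).
  by rewrite cons_uniq zN.
by have := max_card (mem (z :: [:: 0; a; p; a + p; t; a + t; p + t; a + p + t]));
  rewrite (card_uniqP uz) !card_prod card_bool.
Qed.

(* Lines of the Fano plane, whose points are the nonzero vectors of (Z/2)^3. *)
Definition isline (L : {set color3}) :=
  exists a b : color3, [/\ a != 0, b != 0, a != b & L = [set a; b; a + b]].

Lemma isline_neq0 L x : isline L -> x \in L -> x != 0.
Proof.
case=> a [b [a0 b0 ab ->]]; rewrite !inE => /orP[/orP[]|] /eqP-> //.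
by rewrite color3_add_eq0.
Qed.

Lemma isline_thru L x : isline L -> x \in L ->
  exists r : color3, [/\ r != 0, x != r & L = [set x; r; x + r]].
Proof.
move=> LL xL; have x0 := isline_neq0 LL xL.
case: LL xL => a [b [a0 b0 ab ->]]; rewrite !inE => /orP[/orP[]|] /eqP xE.
- by exists b; rewrite xE.
- by exists a; rewrite xE; split; rewrite // 1?eq_sym // (setUC [set a]) addrC.
- exists a; split=> //.
    by rewrite xE -color3_add_eq0 addrAC color3_char2 add0r.
  by rewrite xE addrAC color3_char2 add0r; apply/setP=> z; rewrite !inE; do 3 case: (z == _).
Qed.

Lemma isline_two L x y : isline L -> x \in L -> y \in L -> x != y -> L = [set x; y; x + y].
Proof.
move=> LL xL yL xy; have [r [r0 xr LE]] := isline_thru LL xL.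
move: yL xy; rewrite LE !inE => /orP[/orP[]|] /eqP->; rewrite ?eqxx // color3_addK => _.
by rewrite setUAC.
Qed.

(** With 0 added, the first line is a subgroup of index 2. If neither [c] nor [d] lies on it, both
    are in the other coset, and [c + d] is a common point. *)
Lemma isline_meet L L' : isline L -> isline L' -> exists t, (t \in L) && (t \in L').
Proof.
case=> a [b [a0 b0 ab ->]] [c [d [c0 d0 cd ->]]].
have [cL|cL] := boolP (c \in [set a; b; a + b]); first by exists c; rewrite cL !inE eqxx.
have B : basis a b c by apply: basis_free => //; move: cL; rewrite !inE (negPf c0) /= orbA.
have := basis_span B d; rewrite in_cons (negPf d0) /= !inE => dE.
have [dL|] := boolP (d \in [set a; b; a + b]); first by exists d; rewrite dL !inE eqxx orbT.
rewrite !inE !negb_or => /andP[/andP[/negPf da /negPf db] /negPf dab].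
exists (c + d); rewrite !inE eqxx orbT andbT; move: dE;
    rewrite da db dab [d == c]eq_sym (negPf cd) /=.
by case/or3P=> /eqP->; rewrite [_ + c]addrC color3_addK eqxx ?orbT.
Qed.

(* Two lines of colours sharing [k] are equal or meet only in [k]; for the colour sets at
   the ends of an edge coloured [k] this says that the edge is poor or rich. *)
Definition good (A B : {set color3}) (k : color3) := A = B \/ A :&: B = [set k].

Lemma goodC A B k : good A B k -> good B A k.
Proof. by case=> [->|AB]; [left|right; rewrite setIC]. Qed.

Lemma good_disjoint (k x y z w : color3) : uniq [:: k; x; y; z; w] ->
  good [set k; x; y] [set k; z; w] k.
Proof.
rewrite /= !inE !negb_or => /and5P[/and4P[kx ky kz kw] /and3P[xy xz xw] /andP[yz yw] zw _].
right; apply/setP=> c; rewrite !inE.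
case: (c =P k) => [//|_] /=; case: (c =P x) => [->|_] /=; first by rewrite (negPf xz) (negPf xw).
by case: (c =P y) => [->|//] /=; rewrite (negPf yz) (negPf yw).
Qed.

Lemma line_good A B k : isline A -> isline B -> k \in A -> k \in B -> good A B k.
Proof.
move=> LA LB kA kB; have [AB|nAB] := boolP [exists x, [&& x != k, x \in A & x \in B]].
  case/existsP: AB => x /and3P[xk xA xB]; left.
  by rewrite (isline_two LA kA xA) 1?eq_sym // (isline_two LB kB xB) 1?eq_sym.
right; apply/setP=> x; rewrite !inE; case: eqP => [->|/eqP xk]; first by rewrite kA kB.
by apply: contraNF nAB => /andP[xA xB]; apply/existsP; exists x; rewrite xk xA.
Qed.

Lemma good_imset (pi : color3 -> color3) A B k : injective pi ->
  good A B k -> good (pi @: A) (pi @: B) (pi k).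
Proof.
by move=> inj [->|AB]; [left | right; rewrite -imsetI ?AB ?imset_set1 // => ? ? _ _; apply: inj].
Qed.

(** Both lists are completed to enumerations of [T], and [pi] matches positions. *)
Lemma perm_of_uniq (T : finType) (l1 l2 : seq T) : uniq l1 -> uniq l2 -> size l1 = size l2 ->
  exists2 pi : T -> T, injective pi & map pi l1 = l2.
Proof.
move=> u1 u2 l12.
pose ext l : seq T := l ++ [seq x <- enum T | x \notin l].
have uext l : uniq l -> uniq (ext l).
  move=> ul; rewrite cat_uniq ul filter_uniq ?enum_uniq // andbT; apply/hasPn=> x.
  by rewrite mem_filter => /andP[].
have mext l x : x \in ext l by rewrite mem_cat mem_filter mem_enum andbT orbN.
have sext l : uniq l -> size (ext l) = #|T|.
  by move=> /uext /card_uniqP <-; apply: eq_card => x; rewrite inE mext.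
exists (fun x => nth x (ext l2) (index x (ext l1))).
  move=> x y; have ix z : (index z (ext l1) < size (ext l2))%N.
    by rewrite (sext _ u2) -(sext _ u1) index_mem.
  rewrite (set_nth_default y) // => /eqP; rewrite nth_uniq ?uext // => /eqP xy.
  by rewrite -(nth_index y (mext l1 x)) xy nth_index.
case: l1 u1 l12 => [|x0 l1']; first by case: l2 u2.
move: (x0 :: _) => l1 u1 l12; apply: (@eq_from_nth _ x0); rewrite size_map // => i il.
rewrite (nth_map x0) // (set_nth_default x0); last first.
  by rewrite (sext _ u2) -(sext _ u1) index_mem.
rewrite /ext index_cat mem_nth // index_uniq // nth_cat -l12 il //.
Qed.

Lemma imset3 (T T' : finType) (f : T -> T') x y z : f @: [set x; y; z] = [set f x; f y; f z].
Proof. by rewrite !imsetU !imset_set1. Qed.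

Ltac uniq_by B := move: B; rewrite /basis /= !inE !negb_or => B;
  repeat match goal with H : is_true (_ && _) |- _ => case/andP: H => ? ? end;
  repeat (apply/andP; split); solve [assumption | rewrite eq_sym; assumption | done].

(** The permutation sends the combinations in [basis a p t], in their order, to the list in the
    second [uniq]. The line [Ly] through [a] is one of the three lines with further points
    [p, a + p], or [t, a + t], or [p + t, a + p + t]; the last three hypotheses treat their
    images. *)
Lemma recolor (a p t k l T1 T2 T3 T4 T5 : color3) (Ly P1 P2 : {set color3}) :
  basis a p t -> isline Ly -> a \in Ly ->
  uniq [:: 0; l; T1; T2; T3; k; T4; T5] ->
  good P1 [set k; T1; T2] k -> good P2 [set l; T1; T2] l ->
  good P2 [set l; T3; k] l -> good P2 [set l; T4; T5] l ->
  exists pi : color3 -> color3, [/\ injective pi, pi 0 = 0, pi (a + t) = k, pi a = l &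
    good P1 (pi @: [set a + t; p; a + p]) k /\ good P2 (pi @: Ly) l].
Proof.
move=> B LyL aLy uT g1 g2 g3 g4.
have [pi inj [pi0 pia pip piap pit piat pipt piapt]] := perm_of_uniq B uT erefl.
exists pi; split=> //; rewrite imset3 piat pip piap; split=> //.
have [s [s0 as_ LyE]] := isline_thru LyL aLy.
have := basis_span B s; rewrite LyE imset3 pia in_cons (negPf s0) in_cons eq_sym (negPf as_) /=
    !inE.
case/or4P=> [/eqP->|/eqP->|/eqP->|].
- by rewrite pip piap.
- by rewrite color3_addK pip piap setUAC.
- by rewrite pit piat.
case/or3P=> /eqP->.
- by rewrite color3_addK pit piat setUAC.
- by rewrite addrA pipt piapt.
- by rewrite -addrA color3_addK addrA pipt piapt setUAC.
Qed.

(** Here [k] and [l] are the colours given from outside to the two boundary edges of the core, and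
    [P1], [P2] are the lines at their outer ends. The permutation need not be linear: it suffices to
    list the colours as in [recolor], separately according to which of [P1], [P2] is the line
    through [k] and [l]. *)
Lemma glue_colors (a p t k l : color3) (Ly P1 P2 : {set color3}) :
  basis a p t -> isline Ly -> a \in Ly -> k != l ->
  isline P1 -> k \in P1 -> isline P2 -> l \in P2 ->
  exists pi : color3 -> color3, [/\ injective pi, pi 0 = 0, pi (a + t) = k, pi a = l &
    good P1 (pi @: [set a + t; p; a + p]) k /\ good P2 (pi @: Ly) l].
Proof.
move=> Bapt LyL aLy kl P1L kP1 P2L lP2.
have k0 := isline_neq0 P1L kP1; have l0 := isline_neq0 P2L lP2.
have disj (x y z w e : color3) (P Q : {set color3}) : P = [set x; y; z] -> Q = [set x; w; e] ->
    uniq [:: x; y; z; w; e] -> good P Q x by move=> -> -> ?; apply: good_disjoint.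
have m0 : k + l != 0 by rewrite color3_add_eq0.
have [u0 u0N] : exists u : color3, u \notin [:: 0; k; l; k + l].
  have [|/forallPn[u uN]] := boolP [forall u : color3, u \in [:: 0; k; l; k + l]]; last by exists u.
  set L := [:: 0; k; l; k + l] => /forallP all; have : (#|{: color3}| <= #|L|)%N.
    by apply/subset_leq_card/subsetP=> u _; apply: all.
  by rewrite !card_prod card_bool => /leq_trans/(_ (card_size _)).
(* [u] is chosen on every line among P1, P2 other than the line through k and l *)
have rich_or P x y : isline P -> x \in P -> x != y -> P = [set x; y; x + y] \/ y \notin P.
  by move=> PL xP xy; have [yP|] := boolP (y \in P); [left; apply: isline_two|right].
have thru P x u : isline P -> x \in P -> u \in P -> u != x -> P = [set x; u; x + u].
  by move=> PL xP uP ux; apply: isline_two; rewrite // eq_sym.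
have Nkl P x y u : isline P -> x \in P -> y \notin P -> u \in P -> u != x -> x != y ->
    u \notin [:: 0; x; y; x + y].
  move=> PL xP yP uP ux xy; rewrite !inE !negb_or (isline_neq0 PL uP) ux /=.
  apply/andP; split; first by apply: contraNneq yP => <-.
  apply: contraNneq yP => uE; have := thru P x u PL xP uP ux; rewrite uE color3_addK => ->.
  by rewrite !inE eqxx !orbT.
have kl' : l != k by rewrite eq_sym.
case: (rich_or P1 k l P1L kP1 kl) => [P1E|lP1]; case: (rich_or P2 l k P2L lP2 kl') => [P2E|kP2].
- rewrite [l + k]addrC in P2E; have B : basis k l u0 by apply: basis_free.
  apply: (@recolor a p t k l u0 (k + u0) (k + l) (l + u0) (k + l + u0)) => //.
  + by uniq_by B.
  + by apply: disj P1E erefl _; uniq_by B.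
  + by apply: disj P2E erefl _; uniq_by B.
  + by left; rewrite P2E setUAC.
  + by apply: disj P2E erefl _; uniq_by B.
- have [s [s0 ls P2s]] := isline_thru P2L lP2.
  have sP2 : s \in P2 by rewrite P2s !inE eqxx orbT.
  have sN : s \notin [:: 0; k; l; k + l].
    have := Nkl P2 l k s P2L lP2 kP2 sP2; rewrite eq_sym ls kl' => /(_ isT isT).
    by rewrite !inE addrC (orbCA (s == l)).
  have B : basis k l s by apply: basis_free.
  apply: (@recolor a p t k l s (l + s) (k + l) (k + s) (k + l + s)) => //.
  + by uniq_by B.
  + by apply: disj P1E erefl _; uniq_by B.
  + by left.
  + by apply: disj P2s erefl _; uniq_by B.
  + by apply: disj P2s erefl _; uniq_by B.
- rewrite [l + k]addrC in P2E; have [s [s0 ks P1s]] := isline_thru P1L kP1.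
  have sP1 : s \in P1 by rewrite P1s !inE eqxx orbT.
  have sN : s \notin [:: 0; k; l; k + l].
    by apply: (Nkl P1) => //; rewrite eq_sym.
  have B : basis k l s by apply: basis_free.
  apply: (@recolor a p t k l s (k + s) (k + l) (l + s) (k + l + s)) => //.
  + by uniq_by B.
  + by left.
  + by apply: disj P2E erefl _; uniq_by B.
  + by left; rewrite P2E setUAC.
  + by apply: disj P2E erefl _; uniq_by B.
- have [s /andP[sP1 sP2]] := isline_meet P1L P2L.
  have sk : s != k by apply: contraNneq kP2 => <-.
  have sl : s != l by apply: contraNneq lP1 => <-.
  have P1s := thru P1 k s P1L kP1 sP1 sk; have P2s := thru P2 l s P2L lP2 sP2 sl.
  have sN : s \notin [:: 0; k; l; k + l] by apply: (Nkl P1).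
  have B : basis k l s by apply: basis_free.
  apply: (@recolor a p t k l (k + l) (k + l + s) (k + s) s (l + s)) => //.
  + by uniq_by B.
  + by apply: disj P1s erefl _; uniq_by B.
  + by apply: disj P2s erefl _; uniq_by B.
  + by apply: disj P2s erefl _; uniq_by B.
  + by left.
Qed.

(** * Cubic graphs *)

Section Cubic.
Variables (V E : finType) (s t : E -> V).
Local Notation cut := (edge_cut s t).
Local Notation inside := (inside s t).
Local Notation div := (divergence s t).

Definition star (v : V) : {set E} := [set e | (s e == v) || (t e == v)].

Definition ends (e : E) (x y : V) :=
  (s e == x) && (t e == y) || (s e == y) && (t e == x).

Lemma endsC e x y : ends e x y = ends e y x.
Proof. by rewrite /ends orbC. Qed.

Lemma ends_star e x y : ends e x y -> e \in star x.
Proof. by rewrite inE => /orP[]/andP[h1 h2]; rewrite ?h1 ?h2 ?orbT. Qed.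

Lemma star_ends e x : e \in star x -> exists y, ends e x y.
Proof.
rewrite inE /ends => /orP[] ex; first by exists (t e); rewrite ex eqxx.
by exists (s e); rewrite ex eqxx orbT.
Qed.

Lemma ends_or e x y v : ends e x y -> e \in star v -> v = x \/ v = y.
Proof.
by rewrite inE => /orP[]/andP[/eqP-> /eqP->] /orP[]/eqP->; auto.
Qed.

Lemma ends_cut e x y (X : {set V}) : ends e x y -> x \in X -> (e \in cut X) = (y \notin X).
Proof.
by move=> exy xX; case/orP: exy => /andP[/eqP sx /eqP tx]; rewrite inE sx tx xX;
  case: (_ \in X).
Qed.

Lemma ends_inside e x y (X : {set V}) : ends e x y -> (e \in inside X) = (x \in X) && (y \in X).
Proof. by case/orP=> /andP[/eqP sx /eqP tx]; rewrite inE sx tx // andbC. Qed.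

Lemma cut_ends e (X : {set V}) : e \in cut X -> exists x y, [/\ x \in X, y \notin X & ends e x y].
Proof.
rewrite inE /ends; case: (boolP (s e \in X)) => sX; case: (boolP (t e \in X)) => tX // _.
  by exists (s e), (t e); rewrite !eqxx.
by exists (t e), (s e); rewrite !eqxx orbT.
Qed.

Lemma div_ends e x y v : ends e x y ->
  div (fun e' => e' == e : bool) v = (v == x) + (v == y).
Proof. by rewrite div_edge1 => /orP[]/andP[/eqP-> /eqP->] //; rewrite addrC. Qed.

Hypothesis loopless : forall e, s e != t e.
Hypothesis simple : forall e e' x y, ends e x y -> ends e' x y -> e = e'.
Hypothesis cub : forall v, #|star v| = 3.

Lemma ends_neq e x y : ends e x y -> x != y.
Proof.
have := loopless e => st /orP[]/andP[/eqP<- /eqP<-] //; by rewrite eq_sym.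
Qed.

Lemma star3 e v : e \in star v -> exists e1 e2,
  uniq [:: e; e1; e2] /\ star v = [set e; e1; e2].
Proof.
move=> ev; have := cardsD1 e (star v); rewrite cub ev => -[/esym/eqP/cards2P[e1 [e2 [e12 sE]]]].
exists e1, e2; rewrite -setUA -sE setD1K //=; split=> //.
have : e \notin [set e1; e2] by rewrite -sE !inE eqxx.
by rewrite !inE e12 => ->.
Qed.

Lemma div_star (M : zmodType) (f : E -> M) v : (forall x : M, - x = x) ->
  div f v = \sum_(e in star v) f e.
Proof.
move=> opp; rewrite /divergence opp [RHS](bigID (fun e => s e == v)) /=; congr (_ + _).
  by apply: eq_bigl => e; rewrite inE; case: (s e == v); rewrite ?andbF.
apply: eq_bigl => e; rewrite inE; case: (s e =P v) => [sv|_]; last by rewrite andbT.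
by rewrite andbF; have := loopless e; rewrite sv eq_sym => /negPf.
Qed.

Lemma sum_set3 (M : zmodType) (f : E -> M) e e1 e2 : uniq [:: e; e1; e2] ->
  \sum_(i in [set e; e1; e2]) f i = f e + (f e1 + f e2).
Proof.
rewrite /= !inE negb_or => /and3P[/andP[ee1 ee2] e12 _].
by rewrite -setUA !big_setU1 ?big_set1 ?inE // negb_or ee1.
Qed.

Definition col (c : E -> color3) v : {set color3} := c @: star v.

(** Edges leaving [S] are coloured but need not be poor or rich: their outer ends get their colours
    only when two sets are glued. *)
Definition coloring (S : {set V}) (c : E -> color3) :=
  [/\ forall v e, v \in S -> e \in star v -> c e != 0,
      forall v, v \in S -> {in star v &, injective c} &
      forall e, e \in inside S -> good (col c (s e)) (col c (t e)) (c e)].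

Lemma coloring_ends S c e x y : coloring S c -> x \in S -> y \in S -> ends e x y ->
  good (col c x) (col c y) (c e).
Proof.
case=> _ _ g xS yS exy; have := g e; rewrite (ends_inside _ exy) xS yS => /(_ isT).
by case/orP: exy => /andP[/eqP-> /eqP->] // /goodC.
Qed.

Lemma inj_star3 (c : E -> color3) v e e1 e2 : star v = [set e; e1; e2] ->
  uniq [:: c e; c e1; c e2] -> {in star v &, injective c}.
Proof.
rewrite /= !inE negb_or => -> /and3P[/andP[/eqP h1 /eqP h2] /eqP h3 _] x y.
rewrite !inE => /orP[/orP[]|]/eqP-> /orP[/orP[]|]/eqP-> // h; by rewrite h in h1 h2 h3 *.
Qed.

(* Kirchhoff's law at a cubic vertex says that its three colours form a line. *)
Lemma flow_vertex (f : E -> color3) v : (forall e, e \in star v -> f e != 0) -> div f v = 0 ->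
  {in star v &, injective f} /\ isline (col f v).
Proof.
move=> fn; rewrite (div_star _ _ color3_opp) => f0.
have [e ev] : exists e, e \in star v by apply/card_gt0P; rewrite cub.
have [e1 [e2 [u sE]]] := star3 ev; rewrite sE sum_set3 // in f0.
have e0 := fn e ev; have e10 : f e1 != 0 by apply: fn; rewrite sE !inE eqxx orbT.
have e20 : f e2 != 0 by apply: fn; rewrite sE !inE eqxx !orbT.
have f2 : f e2 = f e + f e1.
  by apply/eqP; rewrite -color3_add_eq0 addrC -addrA f0.
have fe1 : f e != f e1 by rewrite -color3_add_eq0 -f2.
split; last by exists (f e), (f e1); split=> //; rewrite /col sE imset3 f2.
apply: (inj_star3 sE); rewrite /= !inE negb_or fe1 f2 -![f _ == _ + _]color3_add_eq0.
by rewrite color3_addK addrCA color3_char2 addr0 e10 e0.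
Qed.

Lemma coloring_flow (S : {set V}) (f : E -> color3) : (forall v e, v \in S -> e \in star v -> f e
    != 0) ->
  (forall v, v \in S -> div f v = 0) -> coloring S f.
Proof.
move=> fn fd; have fv v (vS : v \in S) := flow_vertex (fun e => fn v e vS) (fd v vS).
split=> // [v vS|e]; first by have [] := fv v vS.
rewrite inE => /andP[sS tS]; have [_ Ls] := fv _ sS; have [_ Lt] := fv _ tS.
by apply: line_good => //; apply: imset_f; rewrite inE eqxx ?orbT.
Qed.

(** * A core with two boundary edges *)

Section Core.
Variable X : {set V}.
Hypothesis cutX : #|cut X| = 2.
Hypothesis conn3 : forall Y : {set V}, Y != set0 -> Y \proper X -> (2 < #|cut Y|)%N.

(** The three colours at [x] are not a line: [d1] alone departs from the flow, by the shift [u]. The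
    second group of conclusions is the input of [glue_colors]. *)
Lemma core_coloring : exists (c : E -> color3) d1 d2 x y a p u,
  [/\ coloring X c, cut X = [set d1;
      d2] /\ d1 != d2, x \in X /\ y \in X & d1 \in star x /\ d2 \in star y] /\
  [/\ basis a p u, c d1 = a + u, c d2 = a, col c x = [set a + u; p; a + p] & isline (col c y)].
Proof.
have /eqP/cards2P[d1 [d2 [d12 cE]]] := cutX.
have d1c : d1 \in cut X by rewrite cE !inE eqxx.
have d2c : d2 \in cut X by rewrite cE !inE eqxx orbT.
have [x [x0 [xX x0X d1x]]] := cut_ends d1c.
have [y [y0 [yX y0X d2y]]] := cut_ends d2c.
have d1v v : v \in X -> d1 \in star v -> v = x.
  by move=> vX /(ends_or d1x)[//|vE]; rewrite vE (negPf x0X) in vX.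
have d2v v : v \in X -> d2 \in star v -> v = y.
  by move=> vX /(ends_or d2y)[//|vE]; rewrite vE (negPf y0X) in vX.
have dout e z w : ends e z w -> z \in X -> w \notin X -> (e = d1 /\ z = x) \/ (e = d2 /\ z = y).
  move=> ezw zX wX; have : e \in cut X by rewrite (ends_cut ezw).
  by rewrite cE => /set2P[] eE; [left|right]; split=> //; [apply: d1v|apply: d2v] => //;
    rewrite -eE (ends_star ezw).
have starx : d1 \in star x := ends_star d1x.
have stary : d2 \in star y := ends_star d2y.
(* Otherwise at most one edge, the third one at [x], would leave [X :\ x]; this set is nonempty
   since the three edges at [x] cannot all be among the two of [cut X]. *)
have xy : x != y.
  apply/negP=> /eqP xy; have := conn3 (Y := X :\ x).
  have sub : cut (X :\ x) \subset star x :\ d1 :\ d2.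
    apply/subsetP=> e /cut_ends[z [w [zY wY ezw]]].
    have [zx zX] := setD1P zY; have es : e \in star z := ends_star ezw.
    have ed1 : e != d1 by apply: contraNneq zx => ee; apply/eqP/d1v; rewrite -?ee.
    have ed2 : e != d2 by apply: contraNneq zx => ee; rewrite xy; apply/eqP/d2v; rewrite -?ee.
    rewrite in_setD1 in_setD1 ed1 ed2 /=; move: wY;
        rewrite in_setD1 negb_and negbK => /orP[/eqP wx|wX].
      by rewrite -wx; apply: (@ends_star _ _ z); rewrite endsC.
    by case: (dout _ _ _ ezw zX wX) => -[ee _]; rewrite ee eqxx in ed1 ed2.
  have small : (#|cut (X :\ x)| <= 1)%N.
    apply: leq_trans (subset_leq_card sub) _.
    have := cardsD1 d1 (star x); have := cardsD1 d2 (star x :\ d1).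
    rewrite in_setD1 eq_sym d12 {2}xy stary starx cub => h1 h2.
    by move: h1 h2; rewrite !add1n => -> [<-].
  rewrite ltnNge (leqW small) => /(_ _ _)/negP H; apply: H => //; last exact: properD1.
  apply/negP=> /eqP X0.
  have : star x \subset cut X.
    apply/subsetP=> e /star_ends[w exw]; rewrite (ends_cut exw) //.
    apply: contraTN (ends_neq exw) => wX; rewrite negbK eq_sym; apply: contraTT wX => wx.
    by have := in_set0 w; rewrite -X0 in_setD1 wx /= => ->.
  by move/subset_leq_card; rewrite cutX cub.
(* At least three edges leave [Z :&: X], and only [d1] among them can leave [X]. *)
have sep (Z : {set V}) : x \in Z -> y \notin Z -> (1 < #|cut Z :&: inside X|)%N.
  move=> xZ yZ; have : (2 < #|cut (Z :&: X)|)%N.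
    apply: conn3; first by apply/set0Pn; exists x; rewrite inE xZ.
    by apply/properP; split; [apply: subsetIr | exists y => //; rewrite inE (negPf yZ)].
  have : cut (Z :&: X) \subset d1 |: (cut Z :&: inside X).
    apply/subsetP=> e /cut_ends[z [w [/setIP[zZ zX] wY ezw]]].
    have [wX|wX] := boolP (w \in X).
      by rewrite in_setU1 in_setI (ends_cut ezw zZ) (ends_inside _ ezw) zX wX;
          rewrite in_setI wX andbT in wY; rewrite wY orbT.
    case: (dout _ _ _ ezw zX wX) => -[ee zE]; first by rewrite ee setU11.
    by rewrite -zE zZ in yZ.
  move/subset_leq_card => le23 gt2; move: (leq_trans gt2 le23); rewrite cardsU1.
  by case: (_ \notin _) => //; rewrite add0n => /ltnW.
have [B [C [cB CX xB yB Bsub]]] := even_cluster sep.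
have BX : B \subset X by apply: Bsub.
(* A set disjoint from [B] avoids [x] and [y], so none of its edges leaves [X]. *)
have h3 (Y : {set V}) : Y != set0 -> Y \subset X :\: B -> (2 < #|cut Y :&: inside X|)%N.
  move=> Yn /subsetP YXB; have YX z : z \in Y -> z \in X by move/YXB => /setDP[].
  have YB z : z \in Y -> z \notin B by move/YXB => /setDP[].
  rewrite (setIidPl _).
    apply: conn3 => //; apply/properP; split; first by apply/subsetP.
    by exists x => //; apply/negP=> /YB; rewrite xB.
  apply/subsetP=> e /cut_ends[z [w [zY wY ezw]]].
  rewrite (ends_inside _ ezw) (YX z zY); apply: contraNT (YB z zY) => wX.
  by case: (dout _ _ _ ezw (YX z zY) wX) => -[_ ->].
have [f [fn fd fC]] := closure_flow cB BX h3.
have [CB Cd Cj] := cB; have [J [JC Jd]] := Cj _ _ xB yB.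
have cutN e : e \in cut X -> e \notin inside X.
  by rewrite !inE; case: (_ \in X); case: (_ \in X).
have d1N := cutN _ d1c; have d2N := cutN _ d2c.
have notC e : e \notin inside X -> e \notin C by apply: contra => /(subsetP CX).
have JN e : e \notin C -> J e = false by move=> eC; apply: contraNF eC => /JC.
have f0 e : e \notin inside X -> f e = 0 by rewrite -fn negbK => /eqP.
have touchB e v : v \in B -> e \in star v -> (f e).1 = (e \in C).
  by move=> vB; rewrite inE => /orP[]/eqP ev; apply: fC; rewrite ev vB ?orbT.
(* A path through [X] that enters by [d1], follows the join [J] inside the trail [C] and leaves by
   [d2]. Adding [(false, al)] along it keeps conservation in [X] and the first coordinate; on [J]
   that coordinate is 1, so no value there becomes zero. *)
pose K e := (J e + ((e == d1) + (e == d2)) : bool).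
pose F (al : color2) e : color3 := f e + scal ((false, al) : color3) (K e).
have Fd1 al : F al d1 = (false, al).
  by rewrite /F f0 // /K JN ?notC // eqxx (negPf d12) add0r.
have Fd2 al : F al d2 = (false, al).
  by rewrite /F f0 // /K JN ?notC // eqxx eq_sym (negPf d12) add0r.
have FJ al e : e != d1 -> e != d2 -> J e = false -> F al e = f e.
  by move=> /negPf h1 /negPf h2 h3'; rewrite /F /K h1 h2 h3' addr0.
have F1 al e v : v \in B -> e \in star v -> (F al e).1 = (e \in C).
  by move=> vB ev; rewrite -(touchB e v vB ev) /F /=; case: (K e); rewrite /= addr0.
have Fdiv al v : v \in X -> div (F al) v = 0.
  move=> vX; rewrite /F divD fd add0r div_scal ?color3_char2 // /K !divD Jd.
  rewrite (div_ends _ d1x) (div_ends _ d2y).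
  have -> : (v == x0) = false by apply: contraNF x0X => /eqP<-.
  have -> : (v == y0) = false by apply: contraNF y0X => /eqP<-.
  by case: (v == x); case: (v == y).
have Fnz al : al != 0 -> forall v e, v \in X -> e \in star v -> F al e != 0.
  move=> al0 v e vX ev; have [->|ed1] := eqVneq e d1.
    by rewrite Fd1; apply: contra_neq al0 => -[].
  have [->|ed2] := eqVneq e d2.
    by rewrite Fd2; apply: contra_neq al0 => -[].
  have [eJ|/negPf eJ] := boolP (J e); last first.
    rewrite FJ // fn; have [w evw] := star_ends ev; rewrite (ends_inside _ evw) vX /=.
    apply: contraNT ed1 => wX; case: (dout _ _ _ evw vX wX) => -[ee _]; first by rewrite ee.
    by rewrite ee eqxx in ed2.
  have eC := JC _ eJ; have := subsetP CB _ eC; rewrite inE => /andP[sB _].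
  have := F1 al e (s e) sB; rewrite inE eqxx eC => /(_ isT).
  by apply: contra_eq_neq => ->.
have [e1 [e2 [ux sx]]] := star3 starx.
have e1x : e1 \in star x by rewrite sx !inE eqxx orbT.
have e2x : e2 \in star x by rewrite sx !inE eqxx !orbT.
have boolN (b : bool) : - b = b by [].
(* [J] has odd degree at [x] and avoids [d1], so it contains [e1] or [e2]; evenness of [C] then
   gives the other one. *)
have [e1C e2C] : e1 \in C /\ e2 \in C.
  have := Cd x; rewrite (div_star _ _ boolN) sx sum_set3 // (negPf (notC _ d1N)).
  have := Jd x; rewrite (div_star _ _ boolN) sx sum_set3 // eqxx (negPf xy) JN ?notC //.
  have := JC e1; have := JC e2.
  by case: (e1 \in C); case: (e2 \in C); case: (J e1); case: (J e2) => // a b;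
      by [move: (a isT) | move: (b isT)].
have e12 : e1 != e2 by move: (ux); rewrite /= !inE => /and3P[].
have C_nbr e : e \in C -> e \in star x -> exists2 x1, ends e x x1 & x1 \in B.
  move=> eC /star_ends[x1 exx1]; exists x1 => //.
  by have := subsetP CB _ eC; rewrite (ends_inside _ exx1) => /andP[].
(* If [x] and [y] were adjacent, only one further edge at each of them could leave [X :\ x :\ y].
   That set is nonempty: simplicity gives [x] another neighbour on the trail. *)
have nonadj e : ~ ends e x y.
  move=> exy; have [e' e'C [ee' e'x]] : exists2 e', e' \in C & e' != e /\ e' \in star x.
    by have [<-|ne] := eqVneq e1 e; [exists e2 => //; rewrite eq_sym | exists e1].
  have [x2 e'xx2 x2B] := C_nbr _ e'C e'x.
  have : (2 < #|cut (X :\ x :\ y)|)%N.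
    apply: conn3; last by apply: sub_proper_trans (subD1set _ _) (properD1 xX).
    apply/set0Pn; exists x2; rewrite !in_setD1 (subsetP BX _ x2B) andbT [x2 == x]eq_sym (ends_neq
        e'xx2) andbT.
    by apply: contraNneq ee' => x2y; rewrite x2y in e'xx2; apply/eqP/(simple e'xx2 exy).
  have : cut (X :\ x :\ y) \subset (star x :\ d1 :\ e) :|: (star y :\ d2 :\ e).
    apply/subsetP=> g /cut_ends[z [w [zY wY gzw]]]; move: zY; rewrite !in_setD1 => /and3P[zy zx zX].
    have gz : g \in star z := ends_star gzw.
    have gw : g \in star w by rewrite endsC in gzw; apply: ends_star gzw.
    have ge : g != e by apply: contraNneq zx => gE; rewrite gE in gz;
        case: (ends_or exy gz) zy => -> //; rewrite eqxx.
    have gd1 : g != d1 by apply: contraNneq zx => gE; apply/eqP/d1v; rewrite -?gE.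
    have gd2 : g != d2 by apply: contraNneq zy => gE; apply/eqP/d2v; rewrite -?gE.
    rewrite in_setU !in_setD1 ge gd1 gd2 /=.
    move: wY; rewrite !in_setD1 !negb_and !negbK => /or3P[/eqP<-|/eqP<-|wX]; rewrite ?gw ?orbT //.
    by case: (dout _ _ _ gzw zX wX) => -[gE _]; rewrite gE eqxx in gd1 gd2.
  have card1 v d : d \in star v -> e \in star v -> d != e -> #|star v :\ d :\ e| = 1%N.
    move=> dv ev de; have := cardsD1 d (star v); have := cardsD1 e (star v :\ d).
    by rewrite in_setD1 eq_sym de dv ev cub /= !add1n => -> [<-].
  move=> sub gt2; have := leq_trans gt2 (subset_leq_card sub).
  rewrite ltnNge (leq_trans (leq_of_leqif (leq_card_setU _ _))) //.
  have ein : e \in inside X by rewrite (ends_inside _ exy) xX yX.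
  have ex := ends_star exy; have ey : e \in star y by rewrite endsC in exy; apply: ends_star exy.
  rewrite !card1 //; first by apply: contraNneq d2N => ->.
  by apply: contraNneq d1N => ->.
(* Among the edges at [x1], only [g2] is off the trail, so its colour is the only one there with
   first coordinate 0. It is different from [d2] by [nonadj] and does not depend on [al]. Thus [be]
   is the single value for which the colour of [d1] would lie on the line at [x1]. *)
have nbr e : e \in C -> e \in star x -> exists x1 be, [/\ ends e x x1, x1 \in X &
    forall al, al != 0 -> al != be -> isline (col (F al) x1) /\ F al d1 \notin col (F al) x1].
  move=> eC ex; have [x1 exx1 x1B] := C_nbr _ eC ex; have x1X := subsetP BX _ x1B.
  have ex1 : e \in star x1 by rewrite endsC in exx1; apply: ends_star exx1.
  have [g1 [g2 [g1C g2C sx1]]] : exists g1 g2, [/\ g1 \in C, g2 \notin C & star x1 = [set e; g1;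
      g2]].
    have [g1 [g2 [ug sx1]]] := star3 ex1.
    have := Cd x1; rewrite (div_star _ _ boolN) sx1 sum_set3 // eC.
    case: (boolP (g1 \in C)) => g1C; case: (boolP (g2 \in C)) => g2C // _; first by exists g1, g2.
    by exists g2, g1; rewrite setUAC.
  have g2x1 : g2 \in star x1 by rewrite sx1 !inE eqxx orbT.
  have g2d1 : g2 != d1.
    by apply: contraTneq (ends_neq exx1) => gd; rewrite (d1v x1) ?eqxx // -gd.
  have g2d2 : g2 != d2.
    apply/negP=> /eqP gd; apply: (nonadj e); rewrite -(d2v x1) // -gd //.
  exists x1, (f g2).2; split=> // al al0 albe.
  have [_ L1] := flow_vertex (fun e => Fnz al al0 x1 e x1X) (Fdiv al x1 x1X).
  split=> //; rewrite Fd1 /col sx1 imset3 !inE !negb_or (FJ _ g2) ?JN //.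
  apply/andP; split; last by apply: contra_neq albe => <-.
  apply/andP; split; apply/negP=> /eqP/(congr1 fst); rewrite (F1 _ _ x1) ?eC ?g1C //.
  by rewrite sx1 !inE eqxx orbT.
have [x1 [be1 [e1x1 x1X nb1]]] := nbr _ e1C e1x.
have [x2 [be2 [e2x2 x2X nb2]]] := nbr _ e2C e2x.
have [al [al0 al1 al2]] := color2_avoid 0 be1 be2.
have [L1 dL1] := nb1 al al0 al1; have [L2 dL2] := nb2 al al0 al2.
have {}Fnz := Fnz al al0.
pose a : color3 := F al d1; pose p : color3 := F al e1.
have aE : F al d1 = a by []. have pE : F al e1 = p by [].
clearbody a p; rewrite aE in dL1 dL2.
have [Fi Lx] := flow_vertex (fun e => Fnz x e xX) (Fdiv al x xX).
have ap : a != p.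
  rewrite -aE -pE; apply/negP=> /eqP/Fi; rewrite starx e1x => /(_ isT isT) de.
  by move: ux; rewrite de /= inE eqxx.
have qE : F al e2 = a + p.
  have := Fdiv al x xX; rewrite (div_star _ _ color3_opp) sx sum_set3 // => /eqP.
  by rewrite addrA aE pE color3_add_eq0 => /eqP.
have a0 : a != 0 by rewrite -aE; apply: (Fnz x).
have p0 : p != 0 by rewrite -pE; apply: (Fnz x).
have pL1 : p \in col (F al) x1 by rewrite -pE; apply: imset_f; rewrite endsC in e1x1;
    apply: ends_star e1x1.
have qL2 : a + p \in col (F al) x2 by rewrite -qE; apply: imset_f; rewrite endsC in e2x2;
    apply: ends_star e2x2.
have pq : p != a + p by rewrite -color3_add_eq0 addrCA color3_char2 addr0.
have [u /andP[uL1 uL2]] := isline_meet L1 L2.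
have ap_line L : isline L -> p \in L -> a + p \in L -> a \in L.
  move=> LL pL qL; rewrite (isline_two LL pL qL pq) !inE addrCA color3_char2 addr0 eqxx.
  by rewrite orbT.
(* If [u] were on the line at [x], then [a] would lie on the line at [x1] or at [x2]: a line
   containing [p] and [a + p] contains [a]. *)
have B3 : basis a p u.
  apply: basis_free => //; rewrite !inE !negb_or (isline_neq0 L1 uL1) /=; apply/and3P; split.
  - by apply: contraNneq dL1 => <-.
  - by apply: contraNneq dL2 => up; apply: ap_line; rewrite // -up.
  - by apply: contraNneq dL1 => uq; apply: ap_line; rewrite // -uq.
pose c e := if e == d1 then a + u else F al e.
have cF e : e != d1 -> c e = F al e by rewrite /c => /negPf->.
have cd1 : c d1 = a + u by rewrite /c eqxx.
move: (ux); rewrite /= !inE negb_or => /and3P[/andP[d1e1 d1e2] _ _].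
have ce1 : c e1 = p by rewrite cF // eq_sym.
have ce2 : c e2 = a + p by rewrite cF 1?eq_sym.
have colx : col c x = [set a + u; p; a + p] by rewrite /col sx imset3 cd1 ce1 ce2.
have star_d1 v e : v \in X -> v != x -> e \in star v -> e != d1.
  by move=> vX vx ev; apply: contraNneq vx => ed; apply/eqP/d1v; rewrite -?ed.
have colv v : v \in X -> v != x -> col c v = col (F al) v.
  by move=> vX vx; apply: eq_in_imset => e ev; apply: cF; apply: star_d1 ev.
exists c, d1, d2, x, y, a, p, u; split; split=> //; first last.
- by rewrite colv 1?eq_sym //; have [] := flow_vertex (fun e => Fnz y e yX) (Fdiv al y yX).
- by rewrite cF 1?eq_sym // Fd2 -aE Fd1.
have auN0 : a + u != 0 by uniq_by B3.
(* The lines at [x1] and [x2] consist of [p], [u], [p + u] and of [a + p], [u], [a + p + u]. Each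
   meets the new colours [a + u], [p], [a + p] at [x] only in the colour of the connecting edge,
   which is therefore rich. *)
have goodx e z : ends e x z -> z \in X -> good (col c x) (col c z) (c e).
  move=> exz zX; have zx : z != x by rewrite eq_sym (ends_neq exz).
  have es := ends_star exz; rewrite colx colv //.
  have ed1 : e != d1.
    by apply: contraNneq x0X => ed; rewrite ed in exz;
        case: (ends_or exz (_ : d1 \in star x0)) => [|->|->] //; rewrite endsC in d1x;
            apply: ends_star d1x.
  move: es; rewrite sx !inE (negPf ed1) => /orP[/eqP eE|/eqP eE]; rewrite eE in exz *.
    have -> : z = x1 by case: (ends_or e1x1 (_ : e1 \in star z)) => // [|zE];
        [rewrite endsC in exz; apply: ends_star exz | rewrite zE eqxx in zx].
    have pu : p != u by uniq_by B3.
    rewrite ce1 (isline_two L1 pL1 uL1 pu) (setUC [set a + u]).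
    by apply: good_disjoint; uniq_by B3.
  have -> : z = x2 by case: (ends_or e2x2 (_ : e2 \in star z)) => // [|zE];
      [rewrite endsC in exz; apply: ends_star exz | rewrite zE eqxx in zx].
  have qu : a + p != u by uniq_by B3.
  rewrite ce2 (isline_two L2 qL2 uL2 qu) setUC setUA.
  by apply: good_disjoint; uniq_by B3.
split.
- move=> v e vX ev; have [->|ed1] := eqVneq e d1; first by rewrite cd1.
  by rewrite cF //; apply: Fnz ev.
- move=> v vX; have [->|vx] := eqVneq v x.
    by apply: (inj_star3 sx); rewrite cd1 ce1 ce2; uniq_by B3.
  have [inj _] := flow_vertex (fun e => Fnz v e vX) (Fdiv al v vX).
  by move=> e e' ev ev'; rewrite !cF ?(star_d1 v) //; apply: inj.
- move=> e; rewrite inE => /andP[sX tX].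
  have [sxE|sNx] := eqVneq (s e) x.
    by rewrite sxE; apply: goodx => //; rewrite /ends sxE !eqxx.
  have [txE|tNx] := eqVneq (t e) x.
    by rewrite txE; apply: goodC; apply: goodx => //; rewrite /ends txE !eqxx orbT.
  have es : e \in star (s e) by rewrite inE eqxx.
  have et : e \in star (t e) by rewrite inE eqxx orbT.
  rewrite !colv // cF ?(star_d1 (s e)) //.
  have [_ Ls] := flow_vertex (fun e' => Fnz (s e) e' sX) (Fdiv al _ sX).
  have [_ Lt] := flow_vertex (fun e' => Fnz (t e) e' tX) (Fdiv al _ tX).
  by apply: line_good => //; apply: imset_f.
Qed.

End Core.
End Cubic.

(** * Gluing colourings of disjoint vertex sets *)

Lemma big_option (I : finType) (M : nmodType) (P : pred (option I)) (F : option I -> M) :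
  \sum_(o | P o) F o = (if P None then F None else 0) + \sum_(i | P (Some i)) F (Some i).
Proof.
rewrite big_mkcond (bigD1 None) //= -big_mkcondr /=; congr (_ + _).
rewrite (reindex_omap Some id) //=; last by case.
by apply: eq_bigl => i; rewrite eqxx andbT.
Qed.

Lemma isline_exists (k : color3) : k != 0 -> exists2 L, isline L & k \in L.
Proof.
move=> k0; have [r /andP[r0 kr]] : exists r : color3, (r != 0) && (k != r).
  by move: k k0 => [[] [[] []]] // _;
      [exists (true, (true, false)) | exists (true, (true, true)) ..].
by exists [set k; r; k + r]; [exists k, r | rewrite !inE eqxx].
Qed.

Section Assembling.
Variables (V E : finType) (s t : E -> V).
Local Notation cut := (edge_cut s t).
Local Notation inside := (inside s t).
Local Notation div := (divergence s t).
Local Notation star := (star s t).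
Local Notation ends := (ends s t).
Local Notation col := (col s t).
Local Notation coloring := (coloring s t).

Hypothesis loopless : forall e, s e != t e.
Hypothesis simple : forall e e' x y, ends e x y -> ends e' x y -> e = e'.
Hypothesis cub : forall v, #|star v| = 3.

Definition colorable (S : {set V}) := exists c, coloring S c.

Lemma col_comp (pi : color3 -> color3) c v : col (pi \o c) v = pi @: col c v.
Proof. exact: imset_comp. Qed.

Lemma coloring_comp (S : {set V}) (pi : color3 -> color3) c : injective pi -> pi 0 = 0 ->
  coloring S c -> coloring S (pi \o c).
Proof.
move=> inj pi0 [cn ci cg]; split=> [v e vS ev|v vS e e' ev ev' /= /inj|e eS].
- by rewrite /= -pi0 (inj_eq inj) (cn v).
- exact: (ci v).
- by rewrite !col_comp; apply: good_imset => //; apply: cg.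
Qed.

Lemma coloring_union (S1 S2 : {set V}) c1 c2 : [disjoint S1 & S2] ->
  coloring S1 c1 -> coloring S2 c2 ->
  (forall e x y, x \in S1 -> y \in S2 -> ends e x y ->
     c1 e = c2 e /\ good (col c1 x) (col c2 y) (c1 e)) ->
  colorable (S1 :|: S2).
Proof.
move=> dS col1 col2 compat.
have [cn1 ci1 cg1] := col1; have [cn2 ci2 cg2] := col2.
pose c e := if (s e \in S2) || (t e \in S2) then c2 e else c1 e.
have cS2 v e : v \in S2 -> e \in star v -> c e = c2 e.
  by rewrite inE /c => vS /orP[]/eqP->; rewrite vS ?orbT.
have cS1 v e : v \in S1 -> e \in star v -> c e = c1 e.
  move=> vS ev; rewrite /c; case: ifP => // touch.
  have [w evw] := star_ends ev; have vS2 := disjointFr dS vS.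
  have wS2 : w \in S2.
    by case/orP: evw touch => /andP[/eqP-> /eqP->]; rewrite vS2 ?orbF.
  by have [] := compat e v w vS wS2 evw.
have colS1 v : v \in S1 -> col c v = col c1 v.
  by move=> vS; apply: eq_in_imset => e; apply: cS1.
have colS2 v : v \in S2 -> col c v = col c2 v.
  by move=> vS; apply: eq_in_imset => e; apply: cS2.
exists c; split.
- by move=> v e /setUP[vS|vS] ev; [rewrite (cS1 v) ?(cn1 v) | rewrite (cS2 v) ?(cn2 v)].
- move=> v /setUP[vS|vS] e e' ev ev'; [rewrite !(cS1 v) | rewrite !(cS2 v)] => //;
    [exact: ci1 ev ev' | exact: ci2 ev ev'].
- move=> e; rewrite inE => /andP[sS tS].
  have es : e \in star (s e) by rewrite inE eqxx.
  have et : e \in star (t e) by rewrite inE eqxx orbT.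
  have est : ends e (s e) (t e) by rewrite /ends !eqxx.
  case/setUP: sS => sS; case/setUP: tS => tS.
  + by rewrite !colS1 // (cS1 (s e)) //; apply: cg1; rewrite inE sS tS.
  + by rewrite colS1 // colS2 // (cS1 (s e)) //; have [] := compat e _ _ sS tS est.
  + rewrite colS2 // colS1 // (cS1 (t e)) //; rewrite endsC in est.
    by apply: goodC; have [] := compat e _ _ tS sS est.
  + by rewrite !colS2 // (cS2 (s e)) //; apply: cg2; rewrite inE sS tS.
Qed.

Lemma coloring_uniq (S : {set V}) c v e e1 e2 : coloring S c -> v \in S -> star v = [set e; e1;
    e2] ->
  uniq [:: e; e1; e2] -> uniq [:: 0; c e; c e1; c e2].
Proof.
case=> cn ci _ vS sv u; have cinj := ci v vS; have cnv e' := cn v e' vS.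
have ev : e \in star v by rewrite sv !inE eqxx.
have e1v : e1 \in star v by rewrite sv !inE eqxx ?orbT.
have e2v : e2 \in star v by rewrite sv !inE eqxx ?orbT.
move: u; rewrite /= !inE !negb_or ![0 == _]eq_sym !cnv //=.
by rewrite !(inj_in_eq cinj).
Qed.

(** If one edge joins the two sets, a permutation fixing 0 carries the colours at its end in [S2] to
    those at its end in [S1], which makes this edge poor. *)
Lemma colorable_union (S1 S2 : {set V}) : [disjoint S1 & S2] ->
  (#|cut S1 :&: inside (S1 :|: S2)| <= 1)%N ->
  colorable S1 -> colorable S2 -> colorable (S1 :|: S2).
Proof.
move=> dS le1 [c1 col1] [c2 col2].
have between e x y : x \in S1 -> y \in S2 -> ends e x y -> e \in cut S1 :&: inside (S1 :|: S2).
  move=> xS yS exy; rewrite in_setI (ends_cut exy) // (disjointFl dS yS) /=.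
  by rewrite (ends_inside _ exy) !in_setU xS yS orbT.
have [cut0|[e0 e0c]] := set_0Vmem (cut S1 :&: inside (S1 :|: S2)).
  apply: (coloring_union dS col1 col2) => e x y xS yS exy.
  by have := between e x y xS yS exy; rewrite cut0 inE.
have [x [y [xS yS1 e0xy]]] := cut_ends (setIP e0c).1.
have yS : y \in S2.
  by move: (setIP e0c).2; rewrite (ends_inside _ e0xy) !in_setU (negPf yS1) => /andP[].
have [a1 [a2 [ua sx]]] := star3 cub (ends_star e0xy).
have [b1 [b2 [ub sy]]] : exists b1 b2, uniq [:: e0; b1; b2] /\ star y = [set e0; b1; b2].
  by apply: (star3 cub); rewrite endsC in e0xy; apply: ends_star e0xy.
have [pi inj [pi0 pi1 pi2 pi3]] := perm_of_uniq (coloring_uniq col2 yS sy ub)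
  (coloring_uniq col1 xS sx ua) erefl.
apply: (coloring_union dS col1 (coloring_comp inj pi0 col2)) => e x' y' x'S y'S exy.
have ee0 : e = e0.
  apply/eqP; apply: contraTT le1 => ne; rewrite -ltnNge; apply/card_gt1P.
  by exists e, e0; split=> //; apply: between exy.
rewrite ee0 in exy *; have x'x : x' = x.
  by case: (ends_or e0xy (ends_star exy)) x'S => // ->; rewrite (negPf yS1).
have y'y : y' = y.
  rewrite endsC in exy; case: (ends_or e0xy (ends_star exy)) y'S => // ->.
  by rewrite (disjointFr dS xS).
rewrite x'x y'y; split; first by rewrite /= pi1.
by left; rewrite col_comp /col sx sy !imset3 pi1 pi2 pi3.
Qed.

Lemma colorable_flow (S : {set V}) :
  (forall Y : {set V}, Y \subset S -> #|cut Y| != 1%N) -> colorable S.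
Proof.
have [-> _|[v0 _]] := set_0Vmem S.
  by exists (fun=> 0); split=> [v e|v|e]; rewrite !inE.
(* The complement of [S] is contracted to one of its vertices. The default value is never taken,
   since a vertex outside [S] exists whenever that branch is reached. *)
move=> bridgeless; pose r v := if v \in S then v else odflt v [pick w | w \notin S].
have rN : exists w0, (forall v, v \notin S -> r v = w0 /\ w0 \notin S).
  have [S0|[w]] := set_0Vmem (~: S).
    by exists v0 => v; rewrite -in_setC S0 inE.
  rewrite inE => wS; exists (odflt w [pick w | w \notin S]) => v vS.
  by rewrite /r (negPf vS); case: pickP => [w' w'S|/(_ w)]; rewrite ?wS.
have [w0 rw] := rN.
have [|Y _|f [fn fd]] := @nowhere_zero_flow V E (r \o s) (r \o t) setT.
- by move=> e; rewrite !inE.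
(* The preimage of [Y] contains all or nothing of the complement of [S], so it or its complement is
   a subset of [S] with the same cut. *)
- rewrite cut_contract; have [w0Y|w0Y] := boolP (w0 \in Y).
    rewrite -cutC; apply: bridgeless; apply/subsetP=> v; rewrite !inE.
    by apply: contraR => /rw[-> _].
  apply: bridgeless; apply/subsetP=> v; rewrite !inE.
  by apply: contraLR => /rw[-> _].
exists f; apply: coloring_flow => // v vS.
rewrite -[RHS](fd v) div_contract (big_pred1 v) // => x /=.
have [xS|xS] := boolP (x \in S); first by rewrite /r xS.
have [-> w0S] := rw x xS; transitivity false; first by apply: contraNF w0S => /eqP->.
by apply/esym; apply: contraNF xS => /eqP->.
Qed.

(** * Sets with a single boundary edge *)

Section Bridge.
Variable S : {set V}.
Hypothesis cutS : #|cut S| = 1%N.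
Hypothesis conn2 : forall Y : {set V}, Y != set0 -> Y \proper S -> (1 < #|cut Y|)%N.

(** Let [v] be the end in [S] of the boundary edge. Removing [v] leaves a set with two boundary
    edges, so there is a smallest such subset of [S :\ v]. Its proper nonempty subsets have at least
    two boundary edges by [conn2], and not exactly two by minimality. *)
Lemma bridge_core : exists X : {set V}, [/\ X \proper S, X != set0, #|cut X| = 2 &
  forall Y : {set V}, Y != set0 -> Y \proper X -> (2 < #|cut Y|)%N].
Proof.
have /eqP/cards1P[e0 cE] := cutS.
have e0c : e0 \in cut S by rewrite cE inE.
have [v [w0 [vS w0S e0vw]]] := cut_ends e0c.
have e0v := ends_star e0vw.
pose P (Y : {set V}) := [&& Y != set0, Y \subset S :\ v & #|cut Y| == 2].
have Sv0 : S :\ v != set0.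
  apply/negP=> /eqP Sv.
  have : star v \subset cut S.
    apply/subsetP=> e /star_ends[w evw]; rewrite (ends_cut evw) //.
    have := ends_neq loopless evw; rewrite eq_sym => wv.
    by have := in_set0 w; rewrite -Sv in_setD1 wv /= => ->.
  by move/subset_leq_card; rewrite cutS cub.
have PS : P (S :\ v).
  rewrite /P Sv0 subxx eqn_leq (conn2 Sv0 (properD1 vS)) andbT.
  have : cut (S :\ v) \subset star v :\ e0.
    apply/subsetP=> e /cut_ends[z [w [zS wS ezw]]].
    have [zv zS'] := setD1P zS; have [wE|wv] := eqVneq w v.
      rewrite in_setD1 -wE; have -> : e \in star w by rewrite endsC in ezw; apply: ends_star ezw.
      rewrite andbT; apply/eqP=> ee; have := ends_star ezw; rewrite ee => /(ends_or e0vw)[].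
        by move/eqP; rewrite (negPf zv).
      by move=> zw; rewrite zw (negPf w0S) in zS'.
    have : e \in cut S by rewrite (ends_cut ezw) //; move: wS; rewrite in_setD1 wv.
    rewrite cE => /set1P ee; have := ends_star ezw; rewrite ee => /(ends_or e0vw)[zE|zE].
      by rewrite zE eqxx in zv.
    by rewrite zE (negPf w0S) in zS'.
  move/subset_leq_card/leq_trans; apply.
  by have := cardsD1 e0 (star v); rewrite e0v cub add1n => -[<-].
have [X PX Xmin] : {X | P X & forall Y, P Y -> (#|X| <= #|Y|)%N}.
  by case: (arg_minnP (fun Y : {set V} => #|Y|) PS) => X; exists X.
have /and3P[X0 XS /eqP cX] := PX.
exists X; split=> //; first exact: sub_proper_trans (properD1 vS).
move=> Y Y0 YX; rewrite ltn_neqAle eq_sym conn2 //; last first.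
  by apply: proper_sub_trans YX (subset_trans XS (subD1set _ _)).
rewrite andbT; apply: contraTN YX => cY; apply/negP=> YX.
have : P Y by rewrite /P Y0 cY (subset_trans (proper_sub YX) XS).
by move/Xmin; rewrite leqNgt (proper_card YX).
Qed.

Lemma colorable_bridge : colorable S.
Proof.
have [X [XS X0 cX conn3]] := bridge_core.
have [cX' [d1 [d2 [x [y [a [p [u [[colX [cE d12] [xX yX] [d1x d2y]]]]]]]]]]] :=
  core_coloring loopless simple cub cX conn3.
case=> B cd1 cd2 colx Ly.
have [e0 _ [w0 w0S]] : exists2 e0, e0 \in cut S & exists w0, w0 \notin S.
  have /eqP/cards1P[e0 cE0] := cutS; exists e0; first by rewrite cE0 inE.
  have : e0 \in cut S by rewrite cE0 inE.
  by case/cut_ends=> v [w0 [_ ? _]]; exists w0.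
have XsS := subsetP (proper_sub XS).
have w0X : w0 \notin X by apply: contra w0S => /XsS.
have xS := XsS x xX.
pose r v := if v \in X then x else if v \in S then v else w0.
(* The new edge [None] runs from the contracted core to the contracted outside. It makes the
   boundary of [S] a cut of size 2, and its nonzero value forces [d1] and [d2] to differ. *)
pose s0 o := if o is Some e then s e else x.
pose t0 o := if o is Some e then t e else w0.
have card0 (Z : {set V}) : #|edge_cut s0 t0 Z| = (((x \in Z) != (w0 \in Z)) + #|cut Z|)%N.
  rewrite (cardsD1 None) inE; congr (_ + _)%N.
  rewrite -[in RHS](card_imset _ Some_inj); apply: eq_card => -[e|]; rewrite !inE /=.
    by rewrite mem_imset ?inE //; apply: Some_inj.
  by apply/esym/negbTE/imsetP => -[].
have noncut (Z : {set V}) : Z \subset S -> ((x \in Z) + #|cut Z|)%N != 1%N.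
  move=> ZS; case: (boolP (x \in Z)) => xZ.
    have [->|ZS'] := eqVneq Z S; first by rewrite cutS.
    have : (1 < #|cut Z|)%N.
      by apply: conn2; [apply/set0Pn; exists x | rewrite properEneq ZS' ZS].
    by case: #|cut Z| => [|[]].
  have [->|Z0] := eqVneq Z set0.
    by rewrite add0n (_ : cut set0 = set0) ?cards0 //; apply/setP=> e; rewrite !inE.
  have : (1 < #|cut Z|)%N.
    by apply: conn2 => //; apply/properP; split=> //; exists x.
  by case: #|cut Z| => [|[]].
have [|Y _|g [gn gd]] := @nowhere_zero_flow V (option E) (r \o s0) (r \o t0) setT.
- by move=> e; rewrite !inE.
- rewrite cut_contract card0; set Z := r @^-1: Y.
  have rout v : v \notin S -> r v = w0.
    by move=> vS; rewrite /r (negPf vS) ifF //; apply: contraNF vS => /XsS.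
  have Zout v : v \notin S -> (v \in Z) = (w0 \in Z).
    by move=> vS; rewrite !inE !rout.
  have [w0Z|w0Z] := boolP (w0 \in Z).
    have := noncut (~: Z); rewrite cutC in_setC; case: (x \in Z); apply; apply/subsetP=> v;
      rewrite in_setC; by apply: contraR => /Zout->.
  have := noncut Z; case: (x \in Z); apply; apply/subsetP=> v; by apply: contraLR => /Zout->.
pose f e := g (Some e).
have rX v : (r v == x) = (v \in X).
  rewrite /r; case: (boolP (v \in X)) => vX; first exact: eqxx.
  case: (boolP (v \in S)) => vS; first by apply: contraNF vX => /eqP->.
  by apply: contraNF w0X => /eqP->.
have fsum : g None + (f d1 + f d2) = 0.
  rewrite -[RHS](gd x) div_contract (eq_bigl (fun v => v \in X)) //.
  rewrite sum_div_cut big_option inE /= xX (negPf w0X); congr (_ + _).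
  rewrite (eq_bigl (fun e => e \in cut X)); last by move=> e; rewrite !inE.
  by rewrite cE big_setU1 ?inE // big_set1.
have kl : f d1 != f d2.
  apply: contra_neq (gn None) => ff; move: fsum.
  by rewrite ff color3_char2 addr0.
have colS : coloring (S :\: X) f /\ forall v, v \in S :\: X -> isline (col f v).
  have fdiv v : v \in S :\: X -> div f v = 0.
    move=> /setDP[vS vX]; rewrite -[RHS](gd v) div_contract (big_pred1 v) => [|z /=].
      rewrite /divergence !big_option /=.
      have -> : (x == v) = false by apply: contraNF vX => /eqP<-.
      have -> : (w0 == v) = false by apply: contraNF w0S => /eqP->.
      by rewrite !add0r.
    rewrite /r; case: (boolP (z \in X)) => zX.
      transitivity false; first by apply: contraNF vX => /eqP<-.
      by apply/esym; apply: contraNF vX => /eqP<-.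
    case: (boolP (z \in S)) => zS //.
    transitivity false; first by apply: contraNF w0S => /eqP->.
    by apply/esym; apply: contraNF zS => /eqP->.
  split; first by apply: coloring_flow => // v e _ _; apply: gn.
  by move=> v vSX; have [|_] := flow_vertex loopless cub (f := f) _ (fdiv v vSX);
      first by move=> e _; apply: gn.
case: colS => colS lineS.
(* At an outer end in [S] the line comes from the flow. An outer end outside [S] imposes no
   condition, and any line through the colour of [d] can stand in. *)
have side d z : d \in cut X -> z \in X -> d \in star z -> exists P, [/\ isline P, f d \in P &
    forall e v z', v \in S :\: X -> z' \in X -> ends e v z' -> e = d -> z' = z /\ col f v = P].
  move=> dX zX dz; have [v dzv] := star_ends dz.
  have vX : v \notin X by rewrite -(ends_cut dzv).
  have uniqv e v' z' : v' \in S :\: X -> z' \in X -> ends e v' z' -> e = d -> z' = z /\ v' = v.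
    move=> /setDP[_ v'X] z'X evz ed; rewrite ed in evz.
    split.
      rewrite endsC in evz; case: (ends_or dzv (ends_star evz)) z'X => // ->.
      by rewrite (negPf vX).
    case: (ends_or dzv (ends_star evz)) v'X => // ->.
    by rewrite zX.
  have [vS|vS] := boolP (v \in S :\: X).
    exists (col f v); split; first exact: lineS.
      by apply: imset_f; rewrite endsC in dzv; apply: ends_star dzv.
    by move=> e v' z' h1 h2 h3 h4; have [-> ->] := uniqv e v' z' h1 h2 h3 h4.
  have [L LL kL] := isline_exists (gn (Some d)); exists L; split=> // e v' z' h1 h2 h3 h4.
  by have [_ vv] := uniqv e v' z' h1 h2 h3 h4; rewrite vv (negPf vS) in h1.
have d1c : d1 \in cut X by rewrite cE !inE eqxx.
have d2c : d2 \in cut X by rewrite cE !inE eqxx orbT.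
have [Q1 [Q1L kQ1 Q1P]] := side d1 x d1c xX d1x.
have [Q2 [Q2L lQ2 Q2P]] := side d2 y d2c yX d2y.
have aLy : a \in col cX' y by rewrite -cd2; apply: imset_f.
have [pi [inj pi0 pik pil [g1 g2]]] := glue_colors B Ly aLy kl Q1L kQ1 Q2L lQ2.
rewrite -(setID S X) (setIidPr (proper_sub XS)) setUC.
apply: (coloring_union _ colS (coloring_comp inj pi0 colX)).
  by rewrite disjoint_sym disjoints_subset; apply/subsetP=> v vX; rewrite !inE vX.
move=> e v z vS zX evz.
have : e \in cut X.
  by rewrite endsC in evz; rewrite (ends_cut evz zX); case/setDP: vS.
rewrite cE => /set2P[] ed.
  have [-> ->] := Q1P e v z vS zX evz ed.
  by rewrite col_comp colx ed /= cd1 pik.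
have [-> ->] := Q2P e v z vS zX evz ed.
by rewrite col_comp ed /= cd2 pil.
Qed.

End Bridge.

(** Once no splitting along at most one edge is possible, [S] itself is the only subset that can
    have exactly one boundary edge, so one of [colorable_bridge] and [colorable_flow] applies. *)
Lemma all_colorable (S : {set V}) : colorable S.
Proof.
have [n] := ubnP #|S|; elim: n S => // n IH S nS.
have [/existsP[X /and3P[X0 XS c1]]|] :=
  boolP [exists X : {set V}, [&& X != set0, X \proper S & (#|cut X :&: inside S| <= 1)%N]].
  have SE : S = X :|: (S :\: X) by rewrite -{1}(setID S X) (setIidPr (proper_sub XS)).
  rewrite SE; apply: colorable_union; rewrite -?SE //.
  - by rewrite -setI_eq0; apply/eqP/setP=> v; rewrite !inE; case: (v \in X).
  - by apply: IH; apply: leq_trans (proper_card XS) nS.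
  - apply: IH; apply: leq_trans (proper_card _) nS; apply/properP; split; first exact: subsetDl.
    have /set0Pn[v vX] := X0; exists v; first exact: (subsetP (proper_sub XS)).
    by rewrite inE vX.
move/existsPn=> conn.
have conn2 (Y : {set V}) : Y != set0 -> Y \proper S -> (1 < #|cut Y|)%N.
  move=> Y0 YS; have := conn Y; rewrite Y0 YS /= -ltnNge => /leq_trans; apply.
  by apply: subset_leq_card; apply: subsetIl.
have [/eqP cS|cS] := boolP (#|cut S| == 1%N); first exact: colorable_bridge.
apply: colorable_flow => Y YS; have [->//|YnS] := eqVneq Y S.
have [->|Y0] := eqVneq Y set0.
  by rewrite (_ : cut set0 = set0) ?cards0 //; apply/setP=> e; rewrite !inE.
by rewrite gtn_eqF // conn2 // properEneq YnS.
Qed.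

End Assembling.

(** * From Fano points to seven colours *)

Definition code (x : color3) : 'I_7 := inord (4 * x.1 + 2 * x.2.1 + x.2.2).-1%N.

(** Zero must be excluded: the predecessor on naturals is truncated, so the zero vector shares its
    code with the vector of binary value 1. *)
Lemma code_inj (x y : color3) : x != 0 -> y != 0 -> code x = code y -> x = y.
Proof.
move=> x0 y0 /(congr1 val); rewrite /= !inordK.
- by move: x y x0 y0 => [[] [[] []]] [[] [[] []]].
- by move: y {y0} => [[] [[] []]].
- by move: x {x0} => [[] [[] []]].
Qed.

Lemma cubic_normal7 (G : sgraph) : cubic G -> has_normal_edge_coloring G 7.
Proof.
move=> cubG.
(* Finite choice orients every edge, which turns the simple graph into a multigraph with maps [s]
   and [t]. *)
have /fin_all_exists[st stP] (e : edge G) : exists p : G * G, val e = [set p.1; p.2] /\ adj p.1 p.2.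
  by case: e => e /= /imset2P[u v _]; rewrite inE => uv ->; exists (u, v).
pose s e := (st e).1; pose t e := (st e).2.
have valE e : val e = [set s e; t e] by have [] := stP e.
have adjE e : adj (s e) (t e) by have [] := stP e.
have starE v : star s t v = [set e : edge G | v \in val e].
  by apply/setP=> e; rewrite !inE valE !inE !(eq_sym v).
have endsE e x y : ends s t e x y -> val e = [set x; y].
  by rewrite valE => /orP[]/andP[/eqP-> /eqP->] //; rewrite setUC.
have adj_neq (u v : G) : adj u v -> u != v.
  by apply: contraTneq => ->; rewrite adj_irrefl.
have loopless e : s e != t e by apply: adj_neq.
have simple e e' x y : ends s t e x y -> ends s t e' x y -> e = e'.
  by move=> /endsE ex /endsE e'x; apply: val_inj; rewrite ex e'x.
have cub v : #|star s t v| = 3 by rewrite starE card_edges_at.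
have [c colc] := all_colorable loopless simple cub setT.
have [cn ci _] := colc.
have c0 e : c e != 0 by apply: (cn (s e)); rewrite ?inE ?eqxx.
pose c7 := [ffun e : edge G => code (c e)].
have colE v : colors_at c7 v = code @: col s t c v.
  rewrite /col -imset_comp starE; apply/setP=> z; rewrite /colors_at.
  by apply/imsetP/imsetP=> -[e ev ->]; exists e; rewrite ?ffunE // inE in ev *.
have colU u v : #|colors_at c7 u :|: colors_at c7 v| = #|col s t c u :|: col s t c v|.
  rewrite !colE -imsetU card_in_imset // => x y.
  by move=> /setUP[]/imsetP[e _ ->] /setUP[]/imsetP[e' _ ->]; apply: code_inj.
have card3 v : #|col s t c v| = 3.
  by rewrite card_in_imset ?cub //; apply: ci.
apply/existsP; exists c7; apply/andP; split.
  apply/forallP=> e; apply/forallP=> f; apply/implyP=> /andP[ef /set0Pn[v /setIP[ve vf]]].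
  apply: contra_neq ef; rewrite !ffunE => /(code_inj (c0 e) (c0 f)).
  by apply: (ci v); rewrite ?in_setT // starE inE.
apply/forallP=> u; apply/forallP=> v; apply/implyP=> uv.
have euv : ends s t (edge_of uv) u v.
  have /setP eE := valE (edge_of uv); have := eE u; have := eE v; have := loopless (edge_of uv).
  rewrite /= !inE !eqxx orbT /= /ends; have := adj_neq u v uv.
  rewrite !(eq_sym u) !(eq_sym v).
  move: (s _) (t _) => a b uNv _ /esym/orP[]/eqP vE /esym/orP[]/eqP uE; subst;
    by rewrite ?eqxx ?orbT // eqxx in uNv *.
apply/orP; rewrite /poor /rich !colU.
(* Equal triples have a union of size 3, and triples sharing one colour have a union of size 3 + 3 -
   1 = 5. *)
have := coloring_ends colc (in_setT u) (in_setT v) euv.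
case=> [->|uvE]; first by left; rewrite setUid card3.
by right; rewrite cardsU !card3 uvE cards1.
Qed.

Local Close Scope ring_scope.

Theorem theorem8 (G : sgraph) (cubG : cubic G) :
  normal_chromatic_index cubG <= 7 /\ has_normal_edge_coloring G 7.
Proof.
have h7 := cubic_normal7 cubG; split=> //.
by rewrite /normal_chromatic_index; case: ex_minnP => m _; apply.
Qed.
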